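(* $$\sum_{n=0}^{\infty} \operatorname{sech}\!\left(\frac{2n+1}{2}\,\pi\right) = \frac{\Gamma\!\left(\frac14\right)^2}{4\sqrt2\,\pi^{3/2}}.$$
   Context: Here $\operatorname{sech} x = 1/\cosh x$ and $\Gamma$ is Euler's Gamma function, $\Gamma(x)=\int_0^\infty u^{x-1}e^{-u}\,du$ for $\Re(x)>0$. *)

(* Defs.v *)
From Stdlib Require Import Reals.
From Coquelicot Require Import Coquelicot.

Local Open Scope R_scope.

Definition sech (x : R) : R := / cosh x.

(* Euler's integral on the real half-line x > 0, improper at both ends.  For
   x <= 0 it diverges, and [RInt_gen] then returns an unspecified value. *)
Definition Gamma (x : R) : R :=
  RInt_gen (fun u : R => Rpower u (x - 1) * exp (- u))
    (at_right 0) (Rbar_locally p_infty).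

(* Main.v *)
Require Import Defs.
From Stdlib Require Import Reals Lra Lia ZArith.
From Coquelicot Require Import Coquelicot.

Local Open Scope R_scope.

(** The proof avoids elliptic functions and Poisson summation; it uses the
    arithmetic-geometric mean, run in two directions.

    For [h > 0] let a(h) and c(h) be the sums of sech(n h) and of sech((n + 1/2) h)
    over all integers n; the series of the theorem is c(pi) / 2. Splitting by
    parity gives a(h) = a(2h) + c(2h) ([theta_even_double]). The less obvious
    relation is c(h)^2 = 4 a(2h) c(2h) ([theta_odd_sqr]): both sides are double
    sums of products sech u sech v, and since
    sech u sech v = (tanh v - tanh u) / sinh (v - u), the products with a fixed
    index difference m telescope to a multiple of m / sinh(m h). The squares on
    the diagonal m = 0 of c(h)^2 are brought to the same form by expanding 1/sinh^2
    in exponentials. With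
    b(h) = a(2h) - c(2h) these relations say that

    - (a(2h), b(2h)) are the arithmetic and geometric means of (a(h), b(h));
    - (a(h), c(h)) is twice the pair of means of (a(2h), c(2h));
    - a^2 = b^2 + c^2.

    Let G(a, b) be the integral of dx / sqrt((x^2 + a^2)(x^2 + b^2)) over the
    half-line. Landen's substitution u = (x - ab/x) / 2 shows that G is unchanged
    when (a, b) is replaced by its means ([gauss_agm]). Doubling h for ever, a and
    b tend to 1, so G(a(h), b(h)) = pi/2. Halving h for ever, h a(h) and h c(h) are
    Riemann sums that tend to the integral pi of sech, so G(a(h), c(h)) = h/2. At
    h = pi both values are pi/2, and as G is strictly decreasing, b(pi) = c(pi) and
    a(pi) = sqrt 2 c(pi). For this ratio one more Landen step leads to the integral
    J of 1 / sqrt(1 + s^4) over [0, 1], with the result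
    pi c(pi) = 2 sqrt 2 J ([theta_odd_PI]).

    Finally Gamma(1/4) is 4 times the integral of exp(-t^4) over the half-line, and
    cutting the square of that integral along the diagonal gives
    Gamma(1/4)^2 = 8 sqrt(pi) J ([int_exp_quart_lim], [Gamma_quarter]). *)

(** * Series of real numbers *)

Lemma series_ext (a b : nat -> R) (l : R) :
  (forall n, a n = b n) -> is_series a l -> is_series b l.
Proof. exact (is_series_ext a b l). Qed.

Lemma series_plus (a b : nat -> R) (la lb : R) :
  is_series a la -> is_series b lb -> is_series (fun n => a n + b n) (la + lb).
Proof. exact (is_series_plus a b la lb). Qed.

Lemma series_scal (k : R) (a : nat -> R) (l : R) :
  is_series a l -> is_series (fun n => k * a n) (k * l).
Proof. exact (is_series_scal k a l). Qed.

Lemma series_decr (a : nat -> R) (l : R) :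
  is_series (fun n => a (S n)) l -> is_series a (a 0%nat + l).
Proof.
  intros H. apply is_series_decr_1.
  change (is_series (fun n => a (S n)) (a 0%nat + l + - a 0%nat)).
  replace (a 0%nat + l + - a 0%nat) with l by ring. exact H.
Qed.

Lemma series_unique (a : nat -> R) (l l' : R) :
  is_series a l -> is_series a l' -> l = l'.
Proof.
  intros H H'. rewrite <- (is_series_unique a l H). exact (is_series_unique a l' H').
Qed.

Lemma sum_n_S (a : nat -> R) (n : nat) : sum_n a (S n) = sum_n a n + a (S n).
Proof. exact (sum_Sn a n). Qed.

Lemma series_telescope (u : nat -> R) (l : R) :
  is_lim_seq u l -> is_series (fun n => u (S n) - u n) (l - u 0%nat).
Proof.
  intros Hu.
  assert (E : forall n, u (S n) - u 0%nat = sum_n (fun k => u (S k) - u k) n).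
  { induction n as [|n IH].
    - rewrite sum_O. reflexivity.
    - rewrite sum_n_S, <- IH. ring. }
  change (is_lim_seq (sum_n (fun k => u (S k) - u k)) (l - u 0%nat)).
  apply is_lim_seq_ext with (1 := E).
  apply is_lim_seq_minus'.
  - now apply is_lim_seq_incr_1 in Hu.
  - apply is_lim_seq_const.
Qed.

Lemma series_bounded (a : nat -> R) (M : R) :
  (forall n, 0 <= a n) -> (forall n, sum_n a n <= M) ->
  exists l : R, is_series a l /\ l <= M.
Proof.
  intros Ha HM.
  destruct (ex_finite_lim_seq_incr (sum_n a) M) as [l Hl].
  - intros n. rewrite sum_n_S. specialize (Ha (S n)). lra.
  - exact HM.
  - exists l. split; [exact Hl|].
    exact (is_lim_seq_le _ _ l M HM Hl (is_lim_seq_const M)).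
Qed.

Lemma sum_n_le_series (a : nat -> R) (l : R) (n : nat) :
  (forall n, 0 <= a n) -> is_series a l -> sum_n a n <= l.
Proof.
  intros Ha Hl. apply (is_lim_seq_incr_compare (sum_n a) l Hl).
  intros k. rewrite sum_n_S. specialize (Ha (S k)). lra.
Qed.

Lemma series_le (a b : nat -> R) (la lb : R) :
  (forall n, a n <= b n) -> is_series a la -> is_series b lb -> la <= lb.
Proof.
  intros H Ha Hb.
  refine (is_lim_seq_le (sum_n a) (sum_n b) la lb _ Ha Hb).
  intros n. apply sum_n_m_le. exact H.
Qed.

Lemma series_pos (a : nat -> R) (l : R) :
  (forall n, 0 < a n) -> is_series a l -> 0 < l.
Proof.
  intros Ha Hl.
  apply Rlt_le_trans with (sum_n a 0).
  - rewrite sum_O. apply Ha.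
  - apply sum_n_le_series; [intros n; apply Rlt_le, Ha | exact Hl].
Qed.

Lemma series_dominated (a b : nat -> R) (lb : R) :
  (forall n, 0 <= a n <= b n) -> is_series b lb ->
  exists l : R, is_series a l /\ l <= lb.
Proof.
  intros H Hb. apply series_bounded.
  - intros n. apply H.
  - intros n. apply Rle_trans with (sum_n b n).
    + apply sum_n_m_le. intros k. apply H.
    + apply sum_n_le_series; [|exact Hb].
      intros k. destruct (H k). lra.
Qed.

(** Finite blocks of a nonnegative array may be summed in either order, so the
    sum of the columns cannot exceed the sum of the rows; by symmetry the two
    are equal. *)
Lemma series_exchange_le (f : nat -> nat -> R) (r c : nat -> R) (S : R) :
  (forall i j, 0 <= f i j) ->
  (forall i, is_series (f i) (r i)) ->
  (forall j, is_series (fun i => f i j) (c j)) ->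
  is_series r S ->
  exists S' : R, is_series c S' /\ S' <= S.
Proof.
  intros Hf Hr Hc HS.
  assert (Hblock : forall n,
    is_series (fun i => sum_n (fun j => f i j) n) (sum_n c n)).
  { induction n as [|n IH].
    - rewrite sum_O. apply series_ext with (2 := Hc 0%nat).
      intros i. rewrite sum_O. reflexivity.
    - rewrite sum_n_S. apply series_ext with (2 := series_plus _ _ _ _ IH (Hc _)).
      intros i. rewrite sum_n_S. reflexivity. }
  apply series_bounded.
  - intros j. apply Rle_trans with (sum_n (fun i => f i j) 0).
    + rewrite sum_O. apply Hf.
    + apply sum_n_le_series; [intros i; apply Hf | apply Hc].
  - intros n. apply (series_le _ _ _ _ (fun i => sum_n_le_series _ _ n (Hf i) (Hr i))).
    + apply Hblock.
    + exact HS.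
Qed.

Lemma series_exchange (f : nat -> nat -> R) (r c : nat -> R) (S : R) :
  (forall i j, 0 <= f i j) ->
  (forall i, is_series (f i) (r i)) ->
  (forall j, is_series (fun i => f i j) (c j)) ->
  is_series r S -> is_series c S.
Proof.
  intros Hf Hr Hc HS.
  destruct (series_exchange_le f r c S Hf Hr Hc HS) as [S' [Hc' Hle]].
  destruct (series_exchange_le (fun i j => f j i) c r S' (fun i j => Hf j i) Hc Hr Hc')
    as [S'' [Hr' Hle']].
  rewrite (series_unique r S'' S Hr' HS) in Hle'.
  replace S with S' by lra. exact Hc'.
Qed.

Lemma series_pairs (f : nat -> R) (l : R) :
  is_series f l -> is_series (fun n => f (2 * n)%nat + f (2 * n + 1)%nat) l.
Proof.
  intros Hf.
  change (is_lim_seq (sum_n (fun n => f (2 * n)%nat + f (2 * n + 1)%nat)) l).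
  apply is_lim_seq_ext with (fun n => sum_n f (2 * n + 1)).
  - induction n as [|n IH].
    + simpl. rewrite sum_n_S, !sum_O. reflexivity.
    + rewrite sum_n_S, <- IH.
      replace (2 * S n + 1)%nat with (S (S (2 * n + 1)))%nat by lia.
      rewrite !sum_n_S.
      replace (S (2 * n + 1))%nat with (2 * S n)%nat by lia. ring.
  - apply (is_lim_seq_subseq (sum_n f) l (fun n => (2 * n + 1)%nat)); [|exact Hf].
    apply eventually_subseq. intros n. lia.
Qed.

(** * Sums over the integers *)

(** The index [-1 - n] makes the two halves of the integers equally long, so that
    the reflection about -1/2, which fixes the half-integers, acts on each term. *)
Definition is_biseries (f : Z -> R) (l : R) : Prop :=
  is_series (fun n => f (Z.of_nat n) + f (-1 - Z.of_nat n)%Z) l.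

Lemma biseries_ext (f g : Z -> R) (l : R) :
  (forall n, f n = g n) -> is_biseries f l -> is_biseries g l.
Proof.
  intros E. apply series_ext. intros n. rewrite !E. reflexivity.
Qed.

Lemma biseries_plus (f g : Z -> R) (lf lg : R) :
  is_biseries f lf -> is_biseries g lg -> is_biseries (fun n => f n + g n) (lf + lg).
Proof.
  intros Hf Hg. apply series_ext with (2 := series_plus _ _ _ _ Hf Hg).
  intros n. simpl. ring.
Qed.

Lemma biseries_scal (k : R) (f : Z -> R) (l : R) :
  is_biseries f l -> is_biseries (fun n => k * f n) (k * l).
Proof.
  intros Hf. apply series_ext with (2 := series_scal k _ _ Hf).
  intros n. simpl. ring.
Qed.

Lemma biseries_unique (f : Z -> R) (l l' : R) :
  is_biseries f l -> is_biseries f l' -> l = l'.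
Proof. apply series_unique. Qed.

Lemma biseries_exchange (F : Z -> Z -> R) (r c : Z -> R) (S : R) :
  (forall n m, 0 <= F n m) ->
  (forall n, is_biseries (F n) (r n)) ->
  (forall m, is_biseries (fun n => F n m) (c m)) ->
  is_biseries r S -> is_biseries c S.
Proof.
  intros HF Hr Hc HS.
  set (opz := fun i => (-1 - Z.of_nat i)%Z).
  apply (series_exchange
    (fun i j => (F (Z.of_nat i) (Z.of_nat j) + F (Z.of_nat i) (opz j))
              + (F (opz i) (Z.of_nat j) + F (opz i) (opz j)))
    (fun i => r (Z.of_nat i) + r (opz i))
    (fun j => c (Z.of_nat j) + c (opz j))).
  - intros i j. repeat apply Rplus_le_le_0_compat; apply HF.
  - intros i. apply series_plus; apply Hr.
  - intros j.
    apply series_ext with (2 := series_plus _ _ _ _ (Hc (Z.of_nat j)) (Hc (opz j))).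
    intros i. unfold opz. ring.
  - exact HS.
Qed.

Definition has_ends (t : Z -> R) (lm lp : R) : Prop :=
  is_lim_seq (fun n => t (Z.of_nat n)) lp /\
  is_lim_seq (fun n => t (- Z.of_nat n)%Z) lm.

Lemma has_ends_succ (t : Z -> R) (lm lp : R) :
  has_ends t lm lp -> has_ends (fun n => t (n + 1)%Z) lm lp.
Proof.
  intros [Hp Hm]. split.
  - apply is_lim_seq_incr_1 in Hp. apply is_lim_seq_ext with (2 := Hp).
    intros n. f_equal. lia.
  - apply is_lim_seq_incr_1. apply is_lim_seq_ext with (2 := Hm).
    intros n. f_equal. lia.
Qed.

Lemma has_ends_pred (t : Z -> R) (lm lp : R) :
  has_ends t lm lp -> has_ends (fun n => t (n - 1)%Z) lm lp.
Proof.
  intros [Hp Hm]. split.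
  - apply is_lim_seq_incr_1. apply is_lim_seq_ext with (2 := Hp).
    intros n. f_equal. lia.
  - apply is_lim_seq_incr_1 in Hm. apply is_lim_seq_ext with (2 := Hm).
    intros n. f_equal. lia.
Qed.

Lemma has_ends_shift (t : Z -> R) (lm lp : R) (m : Z) :
  has_ends t lm lp -> has_ends (fun n => t (n + m)%Z) lm lp.
Proof.
  intros Ht. induction m as [|m IH|m IH] using Z.peano_ind.
  - destruct Ht as [Hp Hm]. split.
    + apply is_lim_seq_ext with (2 := Hp). intros n. f_equal. lia.
    + apply is_lim_seq_ext with (2 := Hm). intros n. f_equal. lia.
  - destruct (has_ends_succ _ _ _ IH) as [Hp Hm]. split.
    + apply is_lim_seq_ext with (2 := Hp). intros n. f_equal. lia.
    + apply is_lim_seq_ext with (2 := Hm). intros n. f_equal. lia.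
  - destruct (has_ends_pred _ _ _ IH) as [Hp Hm]. split.
    + apply is_lim_seq_ext with (2 := Hp). intros n. f_equal. lia.
    + apply is_lim_seq_ext with (2 := Hm). intros n. f_equal. lia.
Qed.

Lemma biseries_telescope1 (t : Z -> R) (lm lp : R) :
  has_ends t lm lp -> is_biseries (fun n => t (n + 1)%Z - t n) (lp - lm).
Proof.
  intros [Hp Hm].
  assert (Hl : is_lim_seq (fun n => t (Z.of_nat n) - t (- Z.of_nat n)%Z) (lp - lm))
    by exact (is_lim_seq_minus' _ _ _ _ Hp Hm).
  replace (lp - lm) with (lp - lm - (t (Z.of_nat 0) - t (- Z.of_nat 0)%Z))
    by (simpl; ring).
  apply series_ext with (2 := series_telescope _ _ Hl).
  intros n. cbv beta.
  replace (Z.of_nat (S n)) with (Z.of_nat n + 1)%Z by lia.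
  replace (-1 - Z.of_nat n + 1)%Z with (- Z.of_nat n)%Z by lia.
  replace (-1 - Z.of_nat n)%Z with (- (Z.of_nat n + 1))%Z by lia. ring.
Qed.

(** A step of length [m] consists of [m] unit steps, each of which contributes the
    total increment of [t]; for negative [m] the steps go backwards. *)
Lemma biseries_telescope (t : Z -> R) (lm lp : R) (m : Z) :
  has_ends t lm lp -> is_biseries (fun n => t (n + m)%Z - t n) (IZR m * (lp - lm)).
Proof.
  intros Ht. induction m as [|m IH|m IH] using Z.peano_ind.
  - change (IZR 0) with 0.
    apply biseries_ext with (2 := biseries_scal 0 _ _ (biseries_telescope1 _ _ _ Ht)).
    intros n. rewrite Z.add_0_r. ring.
  - pose proof (biseries_plus _ _ _ _ IH
      (biseries_telescope1 _ _ _ (has_ends_shift _ _ _ m Ht))) as H.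
    replace (IZR (Z.succ m) * (lp - lm)) with (IZR m * (lp - lm) + (lp - lm))
      by (rewrite succ_IZR; ring).
    apply biseries_ext with (2 := H). intros n. cbv beta.
    replace (n + Z.succ m)%Z with (n + 1 + m)%Z by lia. ring.
  - pose proof (biseries_plus _ _ _ _ IH (biseries_scal (-1) _ _
      (biseries_telescope1 _ _ _ (has_ends_shift _ _ _ (Z.pred m) Ht)))) as H.
    replace (IZR (Z.pred m) * (lp - lm)) with (IZR m * (lp - lm) + -1 * (lp - lm))
      by (unfold Z.pred; rewrite plus_IZR; ring).
    apply biseries_ext with (2 := H). intros n. cbv beta.
    replace (n + 1 + Z.pred m)%Z with (n + m)%Z by lia. ring.
Qed.

Lemma biseries_vanishing (f : Z -> R) (l : R) :
  (forall n, 0 <= f n) -> is_biseries f l -> has_ends f 0 0.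
Proof.
  intros Hf Hl.
  assert (H0 := ex_series_lim_0 _ (ex_intro _ l Hl)).
  split.
  - apply is_lim_seq_le_le with (2 := is_lim_seq_const 0) (3 := H0).
    intros n. specialize (Hf (-1 - Z.of_nat n)%Z) as H1.
    specialize (Hf (Z.of_nat n)). lra.
  - apply is_lim_seq_incr_1.
    apply is_lim_seq_le_le with (2 := is_lim_seq_const 0) (3 := H0).
    intros n. replace (- Z.of_nat (S n))%Z with (-1 - Z.of_nat n)%Z by lia.
    specialize (Hf (-1 - Z.of_nat n)%Z) as H1. specialize (Hf (Z.of_nat n)). lra.
Qed.

(** The difference of the two sums telescopes, and its ends vanish because the
    terms of a convergent series do. *)
Lemma biseries_shift (f : Z -> R) (l : R) (m : Z) :
  (forall n, 0 <= f n) -> is_biseries f l -> is_biseries (fun n => f (n + m)%Z) l.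
Proof.
  intros Hf Hl.
  pose proof (biseries_plus _ _ _ _ Hl
    (biseries_telescope f 0 0 m (biseries_vanishing f l Hf Hl))) as H.
  replace l with (l + IZR m * (0 - 0)) by ring.
  apply biseries_ext with (2 := H). intros n. cbv beta. ring.
Qed.

Lemma biseries_pairs (f : Z -> R) (l : R) :
  is_biseries f l -> is_biseries (fun n => f (2 * n)%Z + f (2 * n + 1)%Z) l.
Proof.
  intros Hf. apply series_ext with (2 := series_pairs _ _ Hf).
  intros n.
  replace (Z.of_nat (2 * n)) with (2 * Z.of_nat n)%Z by lia.
  replace (Z.of_nat (2 * n + 1)) with (2 * Z.of_nat n + 1)%Z by lia.
  replace (2 * (-1 - Z.of_nat n))%Z with (-1 - (2 * Z.of_nat n + 1))%Z by lia.
  replace (-1 - (2 * Z.of_nat n + 1) + 1)%Z with (-1 - 2 * Z.of_nat n)%Z by lia.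
  ring.
Qed.

(** The terms of the two-sided series are f(n) + f(n + 1); half the telescoping
    sum of f(n) - f(n + 1), which is f(0), brings them to f(n + 1) alone. *)
Lemma biseries_even (f : Z -> R) (l : R) :
  (forall n, 0 <= f n) -> (forall n, f (- n)%Z = f n) -> is_biseries f l ->
  is_series (fun n => f (Z.of_nat n + 1)%Z) ((l - f 0%Z) / 2).
Proof.
  intros Hf He Hl.
  pose proof (series_telescope (fun n => f (Z.of_nat n)) 0
    (proj1 (biseries_vanishing f l Hf Hl))) as Ht.
  pose proof (series_scal (/ 2) _ _ (series_plus _ _ _ _ Hl Ht)) as H.
  replace ((l - f 0%Z) / 2) with (/ 2 * (l + (0 - f (Z.of_nat 0)))) by (simpl; field).
  apply series_ext with (2 := H). intros n. cbv beta.
  replace (-1 - Z.of_nat n)%Z with (- (Z.of_nat n + 1))%Z by lia.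
  replace (Z.of_nat (S n)) with (Z.of_nat n + 1)%Z by lia.
  rewrite He. field.
Qed.

Lemma series_even_biseries (f : Z -> R) (l : R) :
  (forall n, f (- n)%Z = f n) ->
  is_series (fun n => f (Z.of_nat n + 1)%Z) l -> is_biseries f (f 0%Z + 2 * l).
Proof.
  intros He Hl.
  assert (H0 : is_lim_seq (fun n => f (Z.of_nat n)) 0).
  { apply is_lim_seq_incr_1.
    apply is_lim_seq_ext with (2 := ex_series_lim_0 _ (ex_intro _ l Hl)).
    intros n. f_equal. lia. }
  pose proof (series_plus _ _ _ _ (series_scal 2 _ _ Hl)
    (series_scal (-1) _ _ (series_telescope _ _ H0))) as H.
  replace (f 0%Z + 2 * l) with (2 * l + -1 * (0 - f (Z.of_nat 0))) by (simpl; ring).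
  apply series_ext with (2 := H). intros n. cbv beta.
  replace (-1 - Z.of_nat n)%Z with (- (Z.of_nat n + 1))%Z by lia.
  replace (Z.of_nat (S n)) with (Z.of_nat n + 1)%Z by lia.
  rewrite He. ring.
Qed.

Lemma biseries_half_symmetric (f : Z -> R) (l : R) :
  (forall n, f (-1 - n)%Z = f n) ->
  is_biseries f l <-> is_series (fun n => f (Z.of_nat n)) (l / 2).
Proof.
  intros He. split; intros H.
  - replace (l / 2) with (/ 2 * l) by field.
    apply series_ext with (2 := series_scal (/ 2) _ _ H).
    intros n. rewrite He. field.
  - replace l with (2 * (l / 2)) by field.
    apply series_ext with (2 := series_scal 2 _ _ H).
    intros n. rewrite He. ring.
Qed.

(** * Hyperbolic functions *)

Lemma lim_inv_p : is_lim Rinv p_infty 0.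
Proof.
  apply (is_lim_inv (fun x => x) p_infty p_infty).
  - apply is_lim_id.
  - discriminate.
Qed.

Lemma cosh_pos (x : R) : 0 < cosh x.
Proof.
  unfold cosh. pose proof (exp_pos x). pose proof (exp_pos (- x)). lra.
Qed.

Lemma sech_pos (x : R) : 0 < sech x.
Proof. apply Rinv_0_lt_compat, cosh_pos. Qed.

Lemma cosh_opp (x : R) : cosh (- x) = cosh x.
Proof. unfold cosh. rewrite Ropp_involutive. now rewrite Rplus_comm. Qed.

Lemma sech_opp (x : R) : sech (- x) = sech x.
Proof. unfold sech. now rewrite cosh_opp. Qed.

Lemma sech_0 : sech 0 = 1.
Proof. unfold sech. rewrite cosh_0. apply Rinv_1. Qed.

Lemma sinh_opp (x : R) : sinh (- x) = - sinh x.
Proof. unfold sinh. rewrite Ropp_involutive. field. Qed.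

Lemma sinh_pos (x : R) : 0 < x -> 0 < sinh x.
Proof. intros Hx. rewrite <- sinh_0. now apply sinh_lt. Qed.

Lemma sinh_neq_0 (x : R) : x <> 0 -> sinh x <> 0.
Proof.
  intros Hx. destruct (Rtotal_order x 0) as [H|[H|H]].
  - apply sinh_lt in H. rewrite sinh_0 in H. lra.
  - contradiction.
  - apply sinh_pos in H. lra.
Qed.

Lemma exp_opp_mul (x : R) : exp x * exp (- x) = 1.
Proof. rewrite <- exp_plus, Rplus_opp_r. apply exp_0. Qed.

Lemma sinh_minus (v u : R) : sinh (v - u) = sinh v * cosh u - cosh v * sinh u.
Proof.
  unfold sinh, cosh, Rminus.
  rewrite Ropp_plus_distr, Ropp_involutive, !exp_plus. field.
Qed.

Lemma cosh_sqr (x : R) : cosh x ^ 2 = 1 + sinh x ^ 2.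
Proof. unfold cosh, sinh. pose proof (exp_opp_mul x). nra. Qed.

(** A product of two [sech] is a difference of [tanh] divided by a factor that
    depends only on the difference of the arguments: this is what makes the sums
    of products at a fixed index difference telescope. *)
Lemma sech_mul (u v : R) : v - u <> 0 ->
  sech u * sech v = (tanh v - tanh u) / sinh (v - u).
Proof.
  intros H. apply sinh_neq_0 in H. pose proof (cosh_pos u). pose proof (cosh_pos v).
  unfold sech.
  replace (tanh v - tanh u) with (sinh (v - u) * (/ cosh u * / cosh v)).
  - field. lra.
  - unfold tanh. rewrite sinh_minus. field. lra.
Qed.

Lemma sech_antitone (u v : R) : 0 <= u <= v -> sech v <= sech u.
Proof.
  intros [Hu Huv]. apply Rinv_le_contravar; [apply cosh_pos|].
  assert (E : cosh v - cosh u = (exp v - exp u) * (1 - exp (- u) * exp (- v)) / 2).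
  { unfold cosh. pose proof (exp_opp_mul u). pose proof (exp_opp_mul v).
    replace ((exp v - exp u) * (1 - exp (- u) * exp (- v)))
      with (exp v - exp u - (exp v * exp (- v)) * exp (- u)
            + (exp u * exp (- u)) * exp (- v)) by ring.
    rewrite H, H0. field. }
  assert (H1 : exp u <= exp v) by (destruct Huv as [h| ->]; [left; now apply exp_increasing|lra]).
  assert (H2 : exp (- u) * exp (- v) <= 1).
  { rewrite <- exp_plus, <- exp_0.
    destruct (Req_dec (- u + - v) 0) as [-> |h]; [lra|left; apply exp_increasing; lra]. }
  nra.
Qed.

Lemma lim_atan : is_lim atan p_infty (PI / 2).
Proof.
  apply is_lim_ext_loc with (fun x => PI / 2 - atan (/ x)).
  - exists 0. intros x Hx. rewrite (atan_inv x Hx). ring.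
  - replace (Finite (PI / 2)) with (Finite (PI / 2 - atan 0))
      by (rewrite atan_0; f_equal; ring).
    apply is_lim_minus'; [apply is_lim_const|].
    apply (filterlim_comp _ _ _ Rinv atan _ (locally 0)).
    + exact lim_inv_p.
    + apply continuity_pt_filterlim, derivable_continuous_pt, derivable_pt_atan.
Qed.

Lemma lim_tanh : is_lim tanh p_infty 1.
Proof.
  apply is_lim_le_le_loc with (fun x => 1 - / x) (fun _ => 1).
  - exists 0. intros x Hx.
    pose proof (exp_ineq1 x ltac:(lra)). pose proof (exp_pos (- x)).
    assert (He : exp (- x) <= / x).
    { rewrite exp_Ropp. apply Rinv_le_contravar; lra. }
    assert (H1 : tanh x = 1 - exp (- x) / cosh x).
    { unfold tanh, cosh, sinh. field. pose proof (exp_pos x). lra. }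
    assert (H2 : 1 <= cosh x).
    { pose proof (sech_antitone 0 x ltac:(lra)) as H2. rewrite sech_0 in H2.
      unfold sech in H2. pose proof (cosh_pos x).
      apply (Rmult_le_compat_r (cosh x)) in H2; [|lra].
      rewrite Rinv_l in H2; lra. }
    assert (0 <= exp (- x) / cosh x <= exp (- x)).
    { split.
      - apply Rlt_le, Rdiv_lt_0_compat; lra.
      - rewrite <- (Rmult_1_r (exp (- x))) at 2. apply Rmult_le_compat_l; [lra|].
        rewrite <- Rinv_1. apply Rinv_le_contravar; lra. }
    lra.
  - replace (Finite 1) with (Finite (1 - 0)) by (f_equal; ring).
    apply is_lim_minus'; [apply is_lim_const|exact lim_inv_p].
  - apply is_lim_const.
Qed.

Lemma lim_seq_affine (x h : R) : 0 < h ->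
  is_lim_seq (fun n => (INR n + x) * h) p_infty.
Proof.
  intros Hh.
  apply is_lim_seq_le_p_loc with (fun n => INR n * h + x * h).
  - exists 0%nat. intros n _. lra.
  - eapply is_lim_seq_plus; [|apply is_lim_seq_const|].
    + apply is_lim_seq_mult with (1 := is_lim_seq_INR) (2 := is_lim_seq_const h).
      apply is_Rbar_mult_p_infty_pos. exact Hh.
    + reflexivity.
Qed.

Lemma tanh_has_ends (x h : R) : 0 < h ->
  has_ends (fun n => tanh ((IZR n + x) * h)) (-1) 1.
Proof.
  intros Hh. split.
  - apply is_lim_seq_ext with (fun n => tanh ((INR n + x) * h)).
    + intros n. now rewrite INR_IZR_INZ.
    + exact (filterlim_comp _ _ _ _ _ _ _ _ (lim_seq_affine x h Hh) lim_tanh).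
  - apply is_lim_seq_ext with (fun n => -1 * tanh ((INR n + - x) * h)).
    + intros n. rewrite opp_IZR, <- INR_IZR_INZ.
      replace ((- INR n + x) * h) with (- ((INR n + - x) * h)) by ring.
      unfold tanh. rewrite sinh_opp, cosh_opp. field.
      apply Rgt_not_eq, cosh_pos.
    + replace (Finite (-1)) with (Rbar_mult (-1) 1) by (simpl; f_equal; ring).
      apply is_lim_seq_scal_l.
      exact (filterlim_comp _ _ _ _ _ _ _ _ (lim_seq_affine (- x) h Hh) lim_tanh).
Qed.

(** * The sums of sech as Riemann sums *)

(** The Gudermannian function, a primitive of [sech] with limit pi/2. *)
Definition gudermann (x : R) : R := atan (sinh x).

Lemma gudermann_derive (x : R) : derivable_pt_lim gudermann x (sech x).
Proof.
  unfold gudermann.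
  replace (sech x) with (/ (1 + sinh x ^ 2) * cosh x).
  - apply (derivable_pt_lim_comp sinh atan).
    + apply derivable_pt_lim_sinh.
    + apply derivable_pt_lim_atan.
  - rewrite <- cosh_sqr. unfold sech. field. apply Rgt_not_eq, cosh_pos.
Qed.

Lemma gudermann_bounds (u v : R) : 0 <= u < v ->
  (v - u) * sech v <= gudermann v - gudermann u <= (v - u) * sech u.
Proof.
  intros [Hu Huv].
  destruct (MVT_cor2 gudermann sech u v Huv (fun c _ => gudermann_derive c))
    as [c [-> Hc]].
  pose proof (sech_antitone u c ltac:(lra)). pose proof (sech_antitone c v ltac:(lra)).
  rewrite (Rmult_comm (sech c)).
  split; apply Rmult_le_compat_l; lra.
Qed.

Lemma gudermann_series (h : R) : 0 < h ->
  is_series (fun n => gudermann ((INR n + 1) * h) - gudermann (INR n * h)) (PI / 2).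
Proof.
  intros Hh.
  assert (Hlim : is_lim_seq (fun n => gudermann (INR n * h)) (PI / 2)).
  { apply (filterlim_comp _ _ _ (fun n => sinh (INR n * h)) atan _ (Rbar_locally p_infty)).
    - apply (is_lim_seq_le_p_loc (fun n => (INR n + 0) * (h / 2))).
      + exists 0%nat. intros n _.
        pose proof (pos_INR n) as Hn.
        assert (Hx : 0 <= INR n * h) by nra.
        assert (He : exp (- (INR n * h)) <= 1).
        { rewrite <- exp_0. destruct Hx as [Hx|<-].
          - left. apply exp_increasing. lra.
          - right. f_equal. ring. }
        assert (He' : 1 + INR n * h <= exp (INR n * h)).
        { destruct Hx as [Hx|<-].
          - left. apply exp_ineq1. lra.
          - rewrite exp_0. lra. }
        unfold sinh. lra.
      + apply lim_seq_affine. lra.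
    - exact lim_atan. }
  replace (PI / 2) with (PI / 2 - gudermann (INR 0 * h)).
  - apply series_ext with (2 := series_telescope _ _ Hlim).
    intros n. now rewrite S_INR.
  - simpl. rewrite Rmult_0_l. unfold gudermann. rewrite sinh_0, atan_0. ring.
Qed.

(** Comparing the sum with the integral of [sech] over the half-line, which is
    pi/2, from the left and from the right endpoints. *)
Lemma sech_sum_bounds (h : R) : 0 < h ->
  exists s : R, is_series (fun n => sech ((INR n + 1) * h)) s /\
            PI / 2 - h <= h * s <= PI / 2.
Proof.
  intros Hh. pose proof (gudermann_series h Hh) as Hg.
  assert (Hn : forall n, 0 <= INR n * h < (INR n + 1) * h).
  { intros n. pose proof (pos_INR n). split; nra. }
  assert (Hdom : forall n, 0 <= h * sech ((INR n + 1) * h)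
      <= gudermann ((INR n + 1) * h) - gudermann (INR n * h)).
  { intros n. split.
    - apply Rlt_le, Rmult_lt_0_compat; [exact Hh|apply sech_pos].
    - pose proof (proj1 (gudermann_bounds _ _ (Hn n))) as H.
      replace ((INR n + 1) * h - INR n * h) with h in H by ring. exact H. }
  destruct (series_dominated _ _ _ Hdom Hg) as [t [Ht Htle]].
  assert (Hs : is_series (fun n => sech ((INR n + 1) * h)) (/ h * t)).
  { apply series_ext with (2 := series_scal (/ h) _ _ Ht). intros n. field. lra. }
  exists (/ h * t). split; [exact Hs|].
  replace (h * (/ h * t)) with t by (field; lra).
  split; [|exact Htle].
  assert (H0 : is_series (fun n => h * sech (INR n * h)) (h + t)).
  { replace (h + t) with (h * sech (INR 0 * h) + t)
      by (simpl; rewrite Rmult_0_l, sech_0; ring).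
    apply (series_decr (fun n => h * sech (INR n * h))).
    apply series_ext with (2 := Ht). intros n. now rewrite S_INR. }
  enough (PI / 2 <= h + t) by lra.
  apply series_le with (2 := Hg) (3 := H0). intros n.
  pose proof (proj2 (gudermann_bounds _ _ (Hn n))) as H.
  replace ((INR n + 1) * h - INR n * h) with h in H by ring. exact H.
Qed.

(** The lower bound compares with the right endpoints. For the upper bound, the
    midpoint value times half a step is below the integral over the left half. *)
Lemma sech_half_sum_bounds (h : R) : 0 < h ->
  exists s : R, is_series (fun n => sech ((INR n + / 2) * h)) s /\
            PI / 2 - h <= h * s <= PI.
Proof.
  intros Hh. pose proof (gudermann_series h Hh) as Hg.
  destruct (sech_sum_bounds h Hh) as [s1 [Hs1 [Hlow _]]].
  assert (Hdom : forall n, 0 <= sech ((INR n + / 2) * h)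
      <= 2 / h * (gudermann ((INR n + 1) * h) - gudermann (INR n * h))).
  { intros n. pose proof (pos_INR n). split; [apply Rlt_le, sech_pos|].
    pose proof (proj1 (gudermann_bounds (INR n * h) ((INR n + / 2) * h)
      ltac:(split; nra))) as H1.
    pose proof (proj1 (gudermann_bounds ((INR n + / 2) * h) ((INR n + 1) * h)
      ltac:(split; nra))) as H2.
    pose proof (sech_pos ((INR n + 1) * h)) as H3.
    apply Rmult_le_reg_l with (h / 2); [lra|].
    replace (h / 2 * (2 / h * (gudermann ((INR n + 1) * h) - gudermann (INR n * h))))
      with (gudermann ((INR n + 1) * h) - gudermann (INR n * h)) by (field; lra).
    nra. }
  destruct (series_dominated _ _ _ Hdom (series_scal (2 / h) _ _ Hg)) as [s [Hs Hle]].
  exists s. split; [exact Hs|]. split.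
  - apply Rle_trans with (1 := Hlow). apply Rmult_le_compat_l; [lra|].
    apply series_le with (2 := Hs1) (3 := Hs). intros n. pose proof (pos_INR n).
    apply sech_antitone. split; nra.
  - apply Rmult_le_compat_l with (r := h) in Hle; [|lra].
    replace (h * (2 / h * (PI / 2))) with PI in Hle by (field; lra). exact Hle.
Qed.

(** The sums of [sech] over the integer and the half-integer multiples of [h],
    extended over both signs. With the nome exp(-h) they are the squares of the
    theta constants theta_3 and theta_2; the square of theta_4 is [theta_diff]
    below. *)
Definition theta_even (h : R) : R := 1 + 2 * Series (fun n => sech ((INR n + 1) * h)).
Definition theta_odd (h : R) : R := 2 * Series (fun n => sech ((INR n + / 2) * h)).

Lemma theta_even_biseries (h : R) : 0 < h ->
  is_biseries (fun n => sech (IZR n * h)) (theta_even h).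
Proof.
  intros Hh. destruct (sech_sum_bounds h Hh) as [s [Hs _]].
  unfold theta_even. rewrite (is_series_unique _ _ Hs).
  replace 1 with (sech (IZR 0 * h)) by (rewrite Rmult_0_l; apply sech_0).
  apply (series_even_biseries (fun n => sech (IZR n * h))).
  - intros n. rewrite opp_IZR, <- Ropp_mult_distr_l. apply sech_opp.
  - apply series_ext with (2 := Hs). intros n. now rewrite plus_IZR, <- INR_IZR_INZ.
Qed.

Lemma theta_odd_biseries (h : R) : 0 < h ->
  is_biseries (fun n => sech ((IZR n + / 2) * h)) (theta_odd h).
Proof.
  intros Hh. destruct (sech_half_sum_bounds h Hh) as [s [Hs _]].
  unfold theta_odd. rewrite (is_series_unique _ _ Hs).
  apply biseries_half_symmetric.
  - intros n. rewrite <- sech_opp. f_equal. rewrite minus_IZR. field.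
  - replace (2 * s / 2) with s by field.
    apply series_ext with (2 := Hs). intros n. now rewrite <- INR_IZR_INZ.
Qed.

Lemma theta_even_bounds (h : R) : 0 < h ->
  PI - h <= h * theta_even h <= PI + h.
Proof.
  intros Hh. destruct (sech_sum_bounds h Hh) as [s [Hs Hb]].
  unfold theta_even. rewrite (is_series_unique _ _ Hs). nra.
Qed.

Lemma theta_odd_bounds (h : R) : 0 < h ->
  PI - 2 * h <= h * theta_odd h <= 2 * PI.
Proof.
  intros Hh. destruct (sech_half_sum_bounds h Hh) as [s [Hs Hb]].
  unfold theta_odd. rewrite (is_series_unique _ _ Hs). nra.
Qed.

Lemma theta_even_gt_1 (h : R) : 0 < h -> 1 < theta_even h.
Proof.
  intros Hh. destruct (sech_sum_bounds h Hh) as [s [Hs Hb]].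
  unfold theta_even. rewrite (is_series_unique _ _ Hs).
  enough (0 < s) by lra.
  apply series_pos with (2 := Hs). intros n. apply sech_pos.
Qed.

Lemma theta_odd_pos (h : R) : 0 < h -> 0 < theta_odd h.
Proof.
  intros Hh. destruct (sech_half_sum_bounds h Hh) as [s [Hs Hb]].
  unfold theta_odd. rewrite (is_series_unique _ _ Hs).
  enough (0 < s) by lra.
  apply series_pos with (2 := Hs). intros n. apply sech_pos.
Qed.

(** * Duplication of the sums of sech *)

Lemma theta_even_double (h : R) : 0 < h ->
  theta_even h = theta_even (2 * h) + theta_odd (2 * h).
Proof.
  intros Hh.
  apply (biseries_unique _ _ _ (biseries_pairs _ _ (theta_even_biseries h Hh))).
  apply biseries_ext with (2 := biseries_plus _ _ _ _
    (theta_even_biseries (2 * h) ltac:(lra)) (theta_odd_biseries (2 * h) ltac:(lra))).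
  intros n. rewrite plus_IZR, mult_IZR. f_equal; f_equal; field.
Qed.

Lemma IZR_mul_neq_0 (m : Z) (h : R) : 0 < h -> m <> 0%Z -> IZR m * h <> 0.
Proof.
  intros Hh Hm H. apply Rmult_integral in H. destruct H as [H|H]; [|lra].
  apply Hm. now apply eq_IZR.
Qed.

Lemma div_sinh_nonneg (x h : R) : 0 < h -> 0 <= x / sinh (x * h).
Proof.
  intros Hh. destruct (Rtotal_order x 0) as [H|[->|H]].
  - replace (x * h) with (- (- x * h)) by ring. rewrite sinh_opp.
    pose proof (sinh_pos (- x * h) ltac:(nra)).
    replace (x / - sinh (- x * h)) with (- x / sinh (- x * h)) by (field; lra).
    apply Rlt_le, Rdiv_lt_0_compat; lra.
  - unfold Rdiv. rewrite Rmult_0_l. lra.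
  - apply Rlt_le, Rdiv_lt_0_compat; [exact H|]. apply sinh_pos. nra.
Qed.

Lemma div_sinh_opp (x h : R) : 0 < h -> - x / sinh (- x * h) = x / sinh (x * h).
Proof.
  intros Hh. destruct (Req_dec x 0) as [->|Hx].
  - rewrite Ropp_0. reflexivity.
  - rewrite <- Ropp_mult_distr_l, sinh_opp. field. apply sinh_neq_0. nra.
Qed.

(** Summing the products of the square along the diagonals of constant index
    difference [m]: for [m <> 0] the addition theorem turns each product into
    a difference of [tanh], which telescopes. *)
Lemma theta_odd_sqr_diagonals (h : R) : 0 < h ->
  exists Q H : R,
    is_series (fun n => sech ((INR n + / 2) * h) ^ 2) Q /\
    is_series (fun n => (INR n + 1) / sinh ((INR n + 1) * h)) H /\
    theta_odd h ^ 2 = 2 * Q + 4 * H.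
Proof.
  intros Hh. pose proof (theta_odd_biseries h Hh) as Hc.
  set (s := fun n : Z => sech ((IZR n + / 2) * h)) in Hc.
  set (c := theta_odd h) in *.
  assert (Hs : forall n, 0 <= s n) by (intros n; apply Rlt_le, sech_pos).
  assert (Hsym : forall n, s (-1 - n)%Z = s n).
  { intros n. unfold s. rewrite <- sech_opp. f_equal. rewrite minus_IZR. field. }
  assert (Hdom : forall n, 0 <= s (Z.of_nat n) ^ 2 <= s (Z.of_nat n)).
  { intros n. split; [apply pow2_ge_0|].
    assert (H1 : s (Z.of_nat n) <= 1).
    { unfold s. rewrite <- sech_0. apply sech_antitone.
      rewrite <- INR_IZR_INZ. pose proof (pos_INR n). nra. }
    specialize (Hs (Z.of_nat n)). nra. }
  destruct (series_dominated _ _ _ Hdom (proj1 (biseries_half_symmetric s c Hsym) Hc))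
    as [Q [HQ _]].
  set (col := fun m : Z => if Z.eq_dec m 0 then 2 * Q else 2 * (IZR m / sinh (IZR m * h))).
  assert (Hcol : is_biseries col (c * c)).
  { apply (biseries_exchange (fun n m => s n * s (n + m)%Z) (fun n => c * s n)).
    - intros n m. now apply Rmult_le_pos.
    - intros n. rewrite Rmult_comm.
      apply (biseries_ext (fun m => s n * s (m + n)%Z)).
      + intros m. now rewrite Z.add_comm.
      + apply biseries_scal. now apply biseries_shift.
    - intros m. unfold col. destruct (Z.eq_dec m 0) as [->|Hm].
      + apply (biseries_ext (fun n => s n ^ 2)).
        * intros n. rewrite Z.add_0_r. ring.
        * apply biseries_half_symmetric.
          -- intros n. now rewrite Hsym.
          -- replace (2 * Q / 2) with Q by field. exact HQ.
      + pose proof (IZR_mul_neq_0 m h Hh Hm) as Hm'.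
        replace (2 * (IZR m / sinh (IZR m * h)))
          with (/ sinh (IZR m * h) * (IZR m * (1 - -1)))
          by (field; now apply sinh_neq_0).
        apply biseries_ext with (2 := biseries_scal (/ sinh (IZR m * h)) _ _
          (biseries_telescope _ _ _ m (tanh_has_ends (/ 2) h Hh))).
        intros n. unfold s. cbv beta.
        assert (E : (IZR (n + m) + / 2) * h - (IZR n + / 2) * h = IZR m * h)
          by (rewrite plus_IZR; ring).
        rewrite sech_mul; rewrite E; [|exact Hm']. unfold Rdiv. ring.
    - now apply biseries_scal. }
  apply biseries_even in Hcol.
  - exists Q, ((c * c - 2 * Q) / 4). split; [|split].
    + apply series_ext with (2 := HQ). intros n. unfold s. now rewrite <- INR_IZR_INZ.
    + replace ((c * c - 2 * Q) / 4) with (/ 2 * ((c * c - col 0%Z) / 2))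
        by (unfold col; simpl; field).
      apply series_ext with (2 := series_scal (/ 2) _ _ Hcol).
      intros n. unfold col. destruct (Z.eq_dec (Z.of_nat n + 1) 0); [lia|].
      rewrite plus_IZR, <- INR_IZR_INZ. field.
      apply sinh_neq_0. pose proof (pos_INR n). nra.
    + field.
  - intros m. unfold col. destruct (Z.eq_dec m 0).
    + assert (0 <= Q); [|lra].
      apply Rle_trans with (2 := sum_n_le_series _ _ 0 (fun n => proj1 (Hdom n)) HQ).
      rewrite sum_O. apply Hdom.
    + pose proof (div_sinh_nonneg (IZR m) h Hh). lra.
  - intros m. unfold col.
    destruct (Z.eq_dec m 0), (Z.eq_dec (- m) 0); try lia; [reflexivity|].
    rewrite opp_IZR, div_sinh_opp by exact Hh. reflexivity.
Qed.

Lemma exp_INR_mul (n : nat) (x : R) : exp (INR n * x) = exp x ^ n.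
Proof.
  induction n as [|n IH].
  - rewrite Rmult_0_l. apply exp_0.
  - rewrite S_INR, Rmult_plus_distr_r, exp_plus, IH, Rmult_1_l. simpl. ring.
Qed.

Lemma exp_neg_bounds (w : R) : 0 < w -> 0 < exp (- w) < 1.
Proof.
  intros Hw. split; [apply exp_pos|]. rewrite <- exp_0. apply exp_increasing. lra.
Qed.

Lemma csch_series (w : R) : 0 < w ->
  is_series (fun n => exp (- (2 * INR n + 1) * w)) (/ (2 * sinh w)).
Proof.
  intros Hw. pose proof (exp_neg_bounds w Hw) as Hq.
  set (q := exp (- w)) in *.
  assert (E : exp w = / q) by (unfold q; now rewrite exp_Ropp, Rinv_inv).
  replace (/ (2 * sinh w)) with (q * / (1 - q ^ 2)).
  - apply (series_ext (fun n => q * (q ^ 2) ^ n)).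
    + intros n. unfold q. rewrite <- !exp_INR_mul, <- exp_plus. f_equal. simpl. ring.
    + apply series_scal, is_series_geom. rewrite Rabs_pos_eq; nra.
  - unfold sinh. fold q. rewrite E. field. nra.
Qed.

(** The Cauchy square of the geometric series. *)
Lemma csch_sqr_series (u : R) : 0 < u ->
  is_series (fun k => 4 * ((INR k + 1) * exp (- (2 * (INR k + 1)) * u))) (/ sinh u ^ 2).
Proof.
  intros Hu. pose proof (exp_neg_bounds u Hu) as Hq.
  set (q := exp (- u)) in *.
  assert (E : exp u = / q) by (unfold q; now rewrite exp_Ropp, Rinv_inv).
  assert (Habs : Rabs (q ^ 2) < 1) by (rewrite Rabs_pos_eq; nra).
  assert (Hex : ex_series (fun n => Rabs ((q ^ 2) ^ n))).
  { exists (/ (1 - q ^ 2)). apply (series_ext (fun n => (q ^ 2) ^ n)).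
    - intros n. rewrite Rabs_pos_eq; [reflexivity|]. apply pow_le, pow2_ge_0.
    - now apply is_series_geom. }
  pose proof (is_series_mult _ _ _ _ (is_series_geom _ Habs) (is_series_geom _ Habs) Hex Hex)
    as H.
  apply (series_scal (4 * q ^ 2)) in H.
  replace (/ sinh u ^ 2) with (4 * q ^ 2 * (/ (1 - q ^ 2) * / (1 - q ^ 2))).
  - apply series_ext with (2 := H). intros k.
    assert (Hk : forall m, (m <= k)%nat ->
      sum_f_R0 (fun i => (q ^ 2) ^ i * (q ^ 2) ^ (k - i)) m = (INR m + 1) * (q ^ 2) ^ k).
    { induction m as [|m IH]; intros Hm.
      - simpl sum_f_R0. rewrite Nat.sub_0_r. simpl. ring.
      - rewrite tech5, IH by lia. rewrite <- pow_add.
        replace (S m + (k - S m))%nat with k by lia. rewrite S_INR. ring. }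
    rewrite Hk by lia.
    replace (exp (- (2 * (INR k + 1)) * u)) with (q ^ 2 * (q ^ 2) ^ k).
    + ring.
    + unfold q. rewrite <- !exp_INR_mul, <- exp_plus. f_equal. simpl. ring.
  - unfold sinh. fold q. rewrite E. field. nra.
Qed.

(** Expanding [csch^2] in exponentials and summing over [n] before [k]. *)
Lemma csch_sqr_sum (h H : R) : 0 < h ->
  is_series (fun n => (INR n + 1) / sinh ((INR n + 1) * h)) H ->
  is_series (fun n => / sinh ((INR n + / 2) * h) ^ 2) (2 * H).
Proof.
  intros Hh HH.
  apply (series_exchange
    (fun k n => 4 * ((INR k + 1) * exp (- (2 * (INR k + 1)) * ((INR n + / 2) * h))))
    (fun k => 2 * ((INR k + 1) / sinh ((INR k + 1) * h)))).
  - intros k n. pose proof (pos_INR k). pose proof (exp_pos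
      (- (2 * (INR k + 1)) * ((INR n + / 2) * h))). nra.
  - intros k. pose proof (pos_INR k) as Hk.
    assert (Hw : 0 < (INR k + 1) * h) by nra. pose proof (sinh_pos _ Hw).
    replace (2 * ((INR k + 1) / sinh ((INR k + 1) * h)))
      with (4 * (INR k + 1) * / (2 * sinh ((INR k + 1) * h))) by (field; lra).
    apply series_ext with (2 := series_scal (4 * (INR k + 1)) _ _ (csch_series _ Hw)).
    intros n. cbv beta.
    replace (- (2 * (INR k + 1)) * ((INR n + / 2) * h))
      with (- (2 * INR n + 1) * ((INR k + 1) * h)) by field. ring.
  - intros n. apply csch_sqr_series. pose proof (pos_INR n). nra.
  - now apply series_scal.
Qed.

(** The exponential series of [csch^2] has positive terms, that of [sech^2] has
    alternating signs: with [csch^2] sums are exchanged without discussing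
    absolute convergence. *)
Lemma sech_sqr_csch_sqr (u : R) : u <> 0 ->
  sech u ^ 2 = / sinh u ^ 2 + -4 * / sinh (2 * u) ^ 2.
Proof.
  intros Hu. apply sinh_neq_0 in Hu. pose proof (cosh_pos u) as Hc.
  replace (sinh (2 * u)) with (2 * sinh u * cosh u).
  - unfold sech. apply (Rmult_eq_reg_r (sinh u ^ 2 * cosh u ^ 2)).
    + field_simplify; try lra. rewrite cosh_sqr. field.
    + apply Rmult_integral_contrapositive. split; apply pow_nonzero; lra.
  - replace (2 * u) with (u - - u) by ring.
    rewrite sinh_minus, sinh_opp, cosh_opp. ring.
Qed.

(** The same diagonal summation for the product of the even and the odd sum;
    adding the product in the opposite order makes both families of products
    run over all integers. *)
Lemma theta_even_odd_diagonals (h : R) : 0 < h ->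
  is_series (fun n => (2 * INR n + 1) / sinh ((2 * INR n + 1) * h))
    (theta_even (2 * h) * theta_odd (2 * h) / 2).
Proof.
  intros Hh. assert (H2h : 0 < 2 * h) by lra.
  pose proof (theta_even_biseries _ H2h) as He.
  pose proof (theta_odd_biseries _ H2h) as Ho.
  set (e := fun n : Z => sech (IZR n * (2 * h))) in He.
  set (o := fun n : Z => sech ((IZR n + / 2) * (2 * h))) in Ho.
  set (E := theta_even (2 * h)) in *. set (O := theta_odd (2 * h)) in *.
  assert (He0 : forall n, 0 <= e n) by (intros n; apply Rlt_le, sech_pos).
  assert (Ho0 : forall n, 0 <= o n) by (intros n; apply Rlt_le, sech_pos).
  set (col := fun m : Z => 2 * ((2 * IZR m + 1) / sinh ((2 * IZR m + 1) * h))).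
  assert (Hcol : is_biseries col (2 * (E * O))).
  { assert (Hrows : is_biseries (fun n => O * e n + E * o n) (2 * (E * O))).
    { replace (2 * (E * O)) with (O * E + E * O) by ring.
      apply biseries_plus; now apply biseries_scal. }
    apply biseries_exchange with (4 := Hrows)
      (F := fun n m => e n * o (n + m)%Z + o n * e (n + m + 1)%Z).
    - intros n m. apply Rplus_le_le_0_compat; now apply Rmult_le_pos.
    - intros n. rewrite (Rmult_comm O), (Rmult_comm E).
      apply (biseries_ext (fun m => e n * o (m + n)%Z + o n * e (m + (n + 1))%Z)).
      + intros m. f_equal; f_equal; f_equal; lia.
      + apply biseries_plus; apply biseries_scal; now apply biseries_shift.
    - intros m. unfold col.
      assert (Hk : (2 * IZR m + 1) * h <> 0).
      { rewrite <- mult_IZR, <- plus_IZR. apply IZR_mul_neq_0; [exact Hh|lia]. }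
      pose proof (tanh_has_ends 0 (2 * h) H2h) as Te.
      pose proof (tanh_has_ends (/ 2) (2 * h) H2h) as To.
      replace (2 * ((2 * IZR m + 1) / sinh ((2 * IZR m + 1) * h)))
        with (/ sinh ((2 * IZR m + 1) * h)
              * (IZR (m + 1) * (1 - -1) + IZR m * (1 - -1)))
        by (rewrite plus_IZR; field; now apply sinh_neq_0).
      apply biseries_ext with (2 := biseries_scal (/ sinh ((2 * IZR m + 1) * h)) _ _
        (biseries_plus _ _ _ _ (biseries_telescope _ _ _ (m + 1) Te)
          (biseries_telescope _ _ _ m To))).
      intros n. unfold e, o. cbv beta.
      assert (E1 : (IZR (n + m) + / 2) * (2 * h) - IZR n * (2 * h) = (2 * IZR m + 1) * h)
        by (rewrite plus_IZR; field).
      assert (E2 : IZR (n + m + 1) * (2 * h) - (IZR n + / 2) * (2 * h)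
                   = (2 * IZR m + 1) * h) by (rewrite !plus_IZR; field).
      rewrite !sech_mul; rewrite ?E1, ?E2; try exact Hk.
      rewrite !Rplus_0_r, Z.add_assoc. unfold Rdiv. ring. }
  apply biseries_half_symmetric in Hcol.
  - replace (E * O / 2) with (/ 2 * (2 * (E * O) / 2)) by field.
    apply series_ext with (2 := series_scal (/ 2) _ _ Hcol).
    intros n. unfold col. rewrite <- INR_IZR_INZ. field.
    apply sinh_neq_0. pose proof (pos_INR n). nra.
  - intros m. unfold col. f_equal.
    replace (2 * IZR (-1 - m) + 1) with (- (2 * IZR m + 1)) by (rewrite minus_IZR; ring).
    now apply div_sinh_opp.
Qed.

(** With H(h) the sum of [m / sinh (m h)] over positive [m], the square is
    8 H(h) - 16 H(2h), which leaves 8 times the part of H(h) with odd [m]; and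
    that part is half the product on the right. *)
Lemma theta_odd_sqr (h : R) : 0 < h ->
  theta_odd h ^ 2 = 4 * theta_even (2 * h) * theta_odd (2 * h).
Proof.
  intros Hh.
  destruct (theta_odd_sqr_diagonals h Hh) as [Q [H [HQ [HH ->]]]].
  destruct (theta_odd_sqr_diagonals (2 * h) ltac:(lra)) as [_ [H' [_ [HH' _]]]].
  assert (EQ : Q = 2 * H + -4 * (2 * H')).
  { apply (series_unique _ _ _ HQ).
    apply series_ext with (2 := series_plus _ _ _ _ (csch_sqr_sum h H Hh HH)
      (series_scal (-4) _ _ (csch_sqr_sum (2 * h) H' ltac:(lra) HH'))).
    intros n.
    replace ((INR n + / 2) * (2 * h)) with (2 * ((INR n + / 2) * h)) by ring.
    rewrite sech_sqr_csch_sqr.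
    - reflexivity.
    - pose proof (pos_INR n). nra. }
  assert (EH : H = theta_even (2 * h) * theta_odd (2 * h) / 2 + 2 * H').
  { apply (series_unique _ _ _ (series_pairs _ _ HH)).
    apply series_ext with (2 := series_plus _ _ _ _ (theta_even_odd_diagonals h Hh)
      (series_scal 2 _ _ HH')).
    intros n. rewrite plus_INR, mult_INR. change (INR 2) with 2. change (INR 1) with 1.
    replace (2 * INR n + 1 + 1) with (2 * (INR n + 1)) by ring.
    replace (2 * (INR n + 1) * h) with ((INR n + 1) * (2 * h)) by ring.
    unfold Rdiv. ring. }
  rewrite EQ, EH. field.
Qed.

(** * Integrals and limits *)

Lemma continuous_ex_RInt (f : R -> R) (a b : R) :
  (forall x, continuous f x) -> ex_RInt f a b.
Proof. intros H. apply (@ex_RInt_continuous R_CompleteNormedModule). intros x _. apply H. Qed.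

Lemma RInt_mult_l (k : R) (f : R -> R) (a b : R) :
  (forall x, continuous f x) -> RInt (fun x => k * f x) a b = k * RInt f a b.
Proof. intros H. apply (RInt_scal f a b k). now apply continuous_ex_RInt. Qed.

Lemma is_derive_RInt_upper (f : R -> R) (a x : R) :
  (forall x, continuous f x) -> is_derive (fun y => RInt f a y) x (f x).
Proof.
  intros H. apply (is_derive_RInt f (fun y => RInt f a y) a x); [|apply H].
  apply filter_forall. intros y. apply (@RInt_correct R_CompleteNormedModule).
  now apply continuous_ex_RInt.
Qed.

Lemma constant_on_positives (D : R -> R) :
  (forall x, 0 < x -> is_derive D x 0) ->
  forall x y, 0 < x -> 0 < y -> D x = D y.
Proof.
  intros H x y Hx Hy. destruct (Rtotal_order x y) as [h|[->|h]].
  - apply eq_is_derive; [|exact h]. intros t Ht. apply H. lra.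
  - reflexivity.
  - symmetry. apply eq_is_derive; [|exact h]. intros t Ht. apply H. lra.
Qed.

Lemma sqrt_lim (f : R -> R) (l : R) :
  (forall x, 0 < x -> 0 <= f x) -> is_lim (fun x => f x ^ 2) p_infty l ->
  is_lim f p_infty (sqrt l).
Proof.
  intros Hf Hl. apply is_lim_ext_loc with (fun x => sqrt (f x ^ 2)).
  - exists 0. intros x Hx. now apply sqrt_pow2, Hf.
  - apply (filterlim_comp _ _ _ (fun x => f x ^ 2) sqrt _ (locally l)); [exact Hl|].
    apply continuous_sqrt.
Qed.

Lemma le_of_geometric_error (x y z : R) :
  (forall k, x <= y + z * (/ 2) ^ k) -> x <= y.
Proof.
  intros H.
  assert (Hl : is_lim_seq (fun k => y + z * (/ 2) ^ k) (y + z * 0)).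
  { apply is_lim_seq_plus'; [apply is_lim_seq_const|].
    apply (is_lim_seq_scal_l (fun k => (/ 2) ^ k) z 0).
    apply is_lim_seq_geom. rewrite Rabs_pos_eq; lra. }
  replace y with (y + z * 0) by ring.
  exact (is_lim_seq_le _ _ x _ H (is_lim_seq_const x) Hl).
Qed.

(** * Complete elliptic integrals and Landen's transformation *)

Definition quartic (s g x : R) : R := x ^ 4 + s * x ^ 2 + g ^ 2.

(** With s = a^2 + b^2 and g = a b the quartic is (x^2 + a^2) (x^2 + b^2).
    Parametrizing by [s] and [g] also covers complex conjugate a^2 and b^2, in
    particular the lemniscatic quartic [x^4 + g^2]. *)
Definition ell (s g x : R) : R := / sqrt (quartic s g x).
Definition ellF (s g x : R) : R := RInt (ell s g) 0 x.

(** The integral of [ell s g] over the whole half-line (see [ellF_lim]), written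
    as a proper integral by means of the symmetry [x -> g / x]. *)
Definition ellL (s g : R) : R := 2 * ellF s g (sqrt g).

Lemma quartic_pos (s g x : R) : 0 < g -> - 2 * g < s -> 0 < quartic s g x.
Proof.
  intros Hg Hs. unfold quartic.
  replace (x ^ 4 + s * x ^ 2 + g ^ 2) with ((x ^ 2 - g) ^ 2 + (s + 2 * g) * x ^ 2) by ring.
  destruct (Req_dec x 0) as [->|Hx].
  - simpl. nra.
  - assert (0 < x ^ 2) by nra. pose proof (pow2_ge_0 (x ^ 2 - g)). nra.
Qed.

Lemma ell_continuous (s g x : R) : 0 < g -> - 2 * g < s -> continuous (ell s g) x.
Proof.
  intros Hg Hs. apply (ex_derive_continuous (ell s g) x).
  pose proof (quartic_pos s g x Hg Hs) as H.
  pose proof (sqrt_lt_R0 _ H). unfold ell, quartic in *. auto_derive.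
  simpl in *. repeat split; auto. lra.
Qed.

Lemma ell_ex_RInt (s g a b : R) : 0 < g -> - 2 * g < s -> ex_RInt (ell s g) a b.
Proof. intros Hg Hs. apply continuous_ex_RInt. intros x. now apply ell_continuous. Qed.

Lemma ellF_derive (s g x : R) : 0 < g -> - 2 * g < s ->
  is_derive (ellF s g) x (ell s g x).
Proof.
  intros Hg Hs. apply (is_derive_RInt_upper (ell s g) 0 x). intros y. now apply ell_continuous.
Qed.

Lemma ellF_0 (s g : R) : ellF s g 0 = 0.
Proof. exact (RInt_point 0 (ell s g)). Qed.

Lemma ell_inversion (s g x : R) : 0 < g -> - 2 * g < s -> 0 < x ->
  ell s g (g / x) * (g / x ^ 2) = ell s g x.
Proof.
  intros Hg Hs Hx. unfold ell.
  pose proof (quartic_pos s g x Hg Hs) as H. pose proof (sqrt_lt_R0 _ H).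
  replace (quartic s g (g / x)) with ((g / x ^ 2) ^ 2 * quartic s g x)
    by (unfold quartic; field; lra).
  assert (0 < g / x ^ 2) by (apply Rdiv_lt_0_compat; [lra|now apply pow_lt]).
  rewrite sqrt_mult_alt by apply pow2_ge_0. rewrite sqrt_pow2 by lra.
  field. lra.
Qed.

Lemma ellF_inversion_derive (s g x : R) : 0 < g -> - 2 * g < s -> 0 < x ->
  is_derive (fun y => ellF s g (g / y)) x (- ell s g x).
Proof.
  intros Hg Hs Hx. rewrite <- (ell_inversion s g x Hg Hs Hx).
  replace (- (ell s g (g / x) * (g / x ^ 2)))
    with (scal (- (g / x ^ 2)) (ell s g (g / x)))
    by (unfold scal; simpl; unfold mult; simpl; ring).
  apply (is_derive_comp (ellF s g) (fun y => g / y)).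
  - now apply ellF_derive.
  - auto_derive; [lra|field; lra].
Qed.

(** The inversion [x -> g / x] preserves [dx / sqrt (quartic x)] up to sign and
    exchanges 0 with infinity, so the complete integral is twice its part below the
    fixed point [sqrt g]. *)
Lemma ellF_inversion (s g x : R) : 0 < g -> - 2 * g < s -> 0 < x ->
  ellF s g x = ellL s g - ellF s g (g / x).
Proof.
  intros Hg Hs Hx. pose proof (sqrt_lt_R0 g Hg) as Hr.
  enough (E : ellF s g x + ellF s g (g / x) = ellF s g (sqrt g) + ellF s g (g / sqrt g)).
  { replace (g / sqrt g) with (sqrt g) in E.
    - unfold ellL. lra.
    - rewrite <- (sqrt_sqrt g) at 2 by lra. field. lra. }
  apply (constant_on_positives (fun y => ellF s g y + ellF s g (g / y))); try assumption.
  intros y Hy. replace 0 with (ell s g y + - ell s g y) by ring.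
  apply (is_derive_plus (ellF s g)).
  - now apply ellF_derive.
  - now apply ellF_inversion_derive.
Qed.

Lemma ellF_inv_lim (s g : R) : 0 < g -> - 2 * g < s ->
  is_lim (fun x => ellF s g (g / x)) p_infty 0.
Proof.
  intros Hg Hs. rewrite <- (ellF_0 s g).
  apply (filterlim_comp _ _ _ (fun x => g / x) (ellF s g) _ (locally 0)).
  - change (is_lim (fun x => g * / x) p_infty 0).
    replace (Finite 0) with (Rbar_mult g 0) by (simpl; f_equal; ring).
    apply is_lim_scal_l, lim_inv_p.
  - apply (ex_derive_continuous (ellF s g) 0). eexists. now apply ellF_derive.
Qed.

Lemma ellF_lim (s g : R) : 0 < g -> - 2 * g < s ->
  is_lim (ellF s g) p_infty (ellL s g).
Proof.
  intros Hg Hs. apply is_lim_ext_loc with (fun x => ellL s g - ellF s g (g / x)).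
  - exists 0. intros x Hx. symmetry. now apply ellF_inversion.
  - replace (Finite (ellL s g)) with (Finite (ellL s g - 0)) by (f_equal; ring).
    apply is_lim_minus'; [apply is_lim_const|now apply ellF_inv_lim].
Qed.

Lemma landen_ell (s g x : R) : 0 < g -> - 2 * g < s -> 0 < x ->
  ell (s / 4 + 3 * g / 2) (sqrt (g * (s + 2 * g)) / 2) ((x - g / x) / 2)
    * ((1 + g / x ^ 2) / 2) = 2 * ell s g x.
Proof.
  intros Hg Hs Hx. unfold ell.
  pose proof (quartic_pos s g x Hg Hs) as H. pose proof (sqrt_lt_R0 _ H).
  assert (H1 : 0 < x + g / x) by (pose proof (Rdiv_lt_0_compat g x Hg Hx); lra).
  assert (H2 : 0 < (x + g / x) / (4 * x)) by (apply Rdiv_lt_0_compat; lra).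
  (* The new quartic is (u^2 + g) (u^2 + (s + 2 g) / 4), whose factors are
     ((x + g / x) / 2)^2 and quartic x / (4 x^2). *)
  replace (quartic (s / 4 + 3 * g / 2) (sqrt (g * (s + 2 * g)) / 2) ((x - g / x) / 2))
    with (((x + g / x) / (4 * x)) ^ 2 * quartic s g x).
  - rewrite sqrt_mult_alt by apply pow2_ge_0. rewrite sqrt_pow2 by lra.
    field. repeat split; try lra.
    replace (x * x + g) with ((x + g / x) * x) by (field; lra). nra.
  - unfold quartic.
    replace ((sqrt (g * (s + 2 * g)) / 2) ^ 2) with (g * (s + 2 * g) / 4).
    + field. lra.
    + rewrite <- (sqrt_sqrt (g * (s + 2 * g))) at 1 by nra. field.
Qed.

(** Landen's substitution [u = (x - g / x) / 2]. *)
Lemma ellF_landen (s g x : R) : 0 < g -> - 2 * g < s -> 0 < x ->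
  ellF (s / 4 + 3 * g / 2) (sqrt (g * (s + 2 * g)) / 2) ((x - g / x) / 2)
    = ellL s g - 2 * ellF s g (g / x).
Proof.
  intros Hg Hs Hx. pose proof (sqrt_lt_R0 g Hg) as Hr.
  set (s' := s / 4 + 3 * g / 2). set (g' := sqrt (g * (s + 2 * g)) / 2).
  assert (Hg' : 0 < g') by (pose proof (sqrt_lt_R0 (g * (s + 2 * g)) ltac:(nra)); unfold g'; lra).
  assert (Hs' : - 2 * g' < s') by (unfold s'; lra).
  enough (E : ellF s' g' ((x - g / x) / 2) - ellF s g x + ellF s g (g / x)
    = ellF s' g' ((sqrt g - g / sqrt g) / 2) - ellF s g (sqrt g) + ellF s g (g / sqrt g)).
  { replace (g / sqrt g) with (sqrt g) in E.
    - replace ((sqrt g - sqrt g) / 2) with 0 in E by field. rewrite ellF_0 in E.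
      rewrite (ellF_inversion s g x Hg Hs Hx) in E. lra.
    - rewrite <- (sqrt_sqrt g) at 2 by lra. field. lra. }
  apply (constant_on_positives (fun y =>
    ellF s' g' ((y - g / y) / 2) - ellF s g y + ellF s g (g / y))); try assumption.
  intros y Hy.
  replace 0 with (2 * ell s g y - ell s g y + - ell s g y) by ring.
  apply (is_derive_plus (fun y => ellF s' g' ((y - g / y) / 2) - ellF s g y)).
  - apply (is_derive_minus (fun y => ellF s' g' ((y - g / y) / 2))).
    + rewrite <- (landen_ell s g y Hg Hs Hy). fold s' g'. rewrite Rmult_comm.
      apply (is_derive_comp (ellF s' g') (fun y => (y - g / y) / 2)).
      * now apply ellF_derive.
      * auto_derive; [lra|field; lra].
    + now apply ellF_derive.
  - now apply ellF_inversion_derive.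
Qed.

Lemma ellL_landen (s g : R) : 0 < g -> - 2 * g < s ->
  ellL s g = ellL (s / 4 + 3 * g / 2) (sqrt (g * (s + 2 * g)) / 2).
Proof.
  intros Hg Hs.
  set (s' := s / 4 + 3 * g / 2). set (g' := sqrt (g * (s + 2 * g)) / 2).
  assert (Hg' : 0 < g') by (pose proof (sqrt_lt_R0 (g * (s + 2 * g)) ltac:(nra)); unfold g'; lra).
  assert (Hs' : - 2 * g' < s') by (unfold s'; lra).
  assert (H1 : is_lim (fun x => ellF s' g' ((x - g / x) / 2)) p_infty (ellL s' g')).
  { apply (filterlim_comp _ _ _ (fun x => (x - g / x) / 2) (ellF s' g') _ (Rbar_locally p_infty)).
    - intros P [M HM]. exists (2 * g + 1 + 4 * Rabs M). intros x Hx. apply HM.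
      pose proof (Rabs_pos M). pose proof (Rle_abs M).
      assert (g / x <= x / 2); [|lra].
      apply (Rmult_le_reg_r x); [lra|].
      unfold Rdiv at 1. rewrite Rmult_assoc, Rinv_l by lra. nra.
    - now apply ellF_lim. }
  assert (H2 : is_lim (fun x => ellF s' g' ((x - g / x) / 2)) p_infty (ellL s g)).
  { apply is_lim_ext_loc with (fun x => ellL s g - 2 * ellF s g (g / x)).
    - exists 0. intros x Hx. symmetry. now apply ellF_landen.
    - replace (Finite (ellL s g)) with (Finite (ellL s g - 2 * 0)) by (f_equal; ring).
      apply is_lim_minus'; [apply is_lim_const|].
      apply (is_lim_scal_l (fun x => ellF s g (g / x)) 2 p_infty 0).
      now apply ellF_inv_lim. }
  apply is_lim_unique in H1. apply is_lim_unique in H2.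
  rewrite H1 in H2. now injection H2.
Qed.

Lemma ellL_antitone (s g s' g' : R) : 0 < g -> - 2 * g < s -> 0 < g' -> - 2 * g' < s' ->
  s <= s' -> g <= g' -> ellL s' g' <= ellL s g.
Proof.
  intros Hg Hs Hg' Hs' Hss Hgg.
  refine (is_lim_le_loc (ellF s' g') (ellF s g) p_infty _ _ _
    (ellF_lim s' g' Hg' Hs') (ellF_lim s g Hg Hs)).
  exists 0. intros x Hx. apply RInt_le; try (now apply ell_ex_RInt); [lra|].
  intros t _. apply Rinv_le_contravar.
  - now apply sqrt_lt_R0, quartic_pos.
  - apply sqrt_le_1_alt. unfold quartic. pose proof (pow2_ge_0 t). nra.
Qed.

Lemma ellL_strictly_antitone (s g s' g' : R) :
  0 < g -> - 2 * g < s -> 0 < g' -> - 2 * g' < s' ->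
  s < s' -> g <= g' -> ellL s' g' < ellL s g.
Proof.
  intros Hg Hs Hg' Hs' Hss Hgg.
  assert (Hle : forall t, ell s' g' t <= ell s g t).
  { intros t. apply Rinv_le_contravar.
    - now apply sqrt_lt_R0, quartic_pos.
    - apply sqrt_le_1_alt. unfold quartic. pose proof (pow2_ge_0 t). nra. }
  assert (H1 : ellF s' g' 1 < ellF s g 1).
  { apply RInt_lt; [lra| | |].
    - intros t _. now apply ell_continuous.
    - intros t _. now apply ell_continuous.
    - intros t Ht. apply Rinv_lt_contravar.
      + apply Rmult_lt_0_compat; now apply sqrt_lt_R0, quartic_pos.
      + apply sqrt_lt_1_alt. split; [now apply Rlt_le, quartic_pos|].
        unfold quartic. assert (0 < t ^ 2) by nra. nra. }
  enough (ellL s' g' <= ellL s g - (ellF s g 1 - ellF s' g' 1)) by lra.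
  refine (is_lim_le_loc (ellF s' g') (fun x => ellF s g x - (ellF s g 1 - ellF s' g' 1))
    p_infty _ (ellL s g - (ellF s g 1 - ellF s' g' 1)) _ (ellF_lim s' g' Hg' Hs') _).
  - exists 1. intros x Hx.
    assert (E : forall s g, 0 < g -> - 2 * g < s ->
      ellF s g x = ellF s g 1 + RInt (ell s g) 1 x).
    { intros a b Ha Hb. symmetry. apply (RInt_Chasles (ell a b)); now apply ell_ex_RInt. }
    rewrite (E s g Hg Hs), (E s' g' Hg' Hs').
    assert (RInt (ell s' g') 1 x <= RInt (ell s g) 1 x); [|lra].
    apply RInt_le; try (now apply ell_ex_RInt); [lra|]. intros t _. apply Hle.
  - apply is_lim_minus'; [now apply ellF_lim|apply is_lim_const].
Qed.

Lemma ellL_scale (t s g : R) : 0 < t -> 0 < g -> - 2 * g < s ->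
  ellL (t ^ 2 * s) (t ^ 2 * g) = ellL s g / t.
Proof.
  intros Ht Hg Hs. pose proof (sqrt_lt_R0 g Hg) as Hr.
  assert (Ht2 : 0 < t ^ 2) by nra.
  assert (Hex : forall a b, ex_RInt (ell (t ^ 2 * s) (t ^ 2 * g)) a b)
    by (intros a b; apply ell_ex_RInt; nra).
  unfold ellL.
  replace (sqrt (t ^ 2 * g)) with (t * sqrt g)
    by (rewrite sqrt_mult_alt, sqrt_pow2 by lra; reflexivity).
  enough (E : ellF (t ^ 2 * s) (t ^ 2 * g) (t * sqrt g) = / t * ellF s g (sqrt g))
    by (rewrite E; unfold Rdiv; ring).
  unfold ellF.
  pose proof (RInt_comp_lin (ell (t ^ 2 * s) (t ^ 2 * g)) t 0 0 (sqrt g) (Hex _ _)) as E.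
  replace (t * 0 + 0) with 0 in E by ring.
  replace (t * sqrt g + 0) with (t * sqrt g) in E by ring.
  rewrite <- E.
  transitivity (RInt (fun x => / t * ell s g x) 0 (sqrt g));
    [|apply (RInt_scal (ell s g) 0 (sqrt g) (/ t)); now apply ell_ex_RInt].
  apply RInt_ext. intros x _.
  change (t * ell (t ^ 2 * s) (t ^ 2 * g) (t * x + 0) = / t * ell s g x).
  rewrite Rplus_0_r. unfold ell.
  replace (quartic (t ^ 2 * s) (t ^ 2 * g) (t * x)) with ((t ^ 2) ^ 2 * quartic s g x)
    by (unfold quartic; ring).
  rewrite sqrt_mult_alt by apply pow2_ge_0. rewrite sqrt_pow2 by lra.
  pose proof (sqrt_lt_R0 _ (quartic_pos s g x Hg Hs)). field. lra.
Qed.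

(** Gauss's complete integral of [dx / sqrt ((x^2 + a^2) (x^2 + b^2))]. *)
Definition gauss (a b : R) : R := ellL (a ^ 2 + b ^ 2) (a * b).

Lemma gauss_diag (a : R) : 0 < a -> gauss a a = PI / (2 * a).
Proof.
  intros Ha. unfold gauss, ellL. rewrite sqrt_square by lra.
  assert (E : is_RInt (ell (a ^ 2 + a ^ 2) (a * a)) 0 a (atan (a / a) / a - atan (0 / a) / a)).
  { apply (is_RInt_derive (fun x => atan (x / a) / a)).
    - intros x _. unfold ell.
      replace (quartic (a ^ 2 + a ^ 2) (a * a) x) with ((x ^ 2 + a ^ 2) ^ 2)
        by (unfold quartic; ring).
      rewrite sqrt_pow2 by nra. auto_derive; [easy|]. field. split; nra.
    - intros x _. apply ell_continuous; nra. }
  unfold ellF. rewrite (is_RInt_unique _ _ _ _ E).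
  replace (a / a) with 1 by (field; lra). replace (0 / a) with 0 by (field; lra).
  rewrite atan_1, atan_0. field. lra.
Qed.

Lemma gauss_bounds (a b : R) : 0 < b <= a ->
  PI / (2 * a) <= gauss a b <= PI / (2 * b).
Proof.
  intros Hab. rewrite <- !gauss_diag by lra.
  split; apply ellL_antitone; nra.
Qed.

(** Landen's transformation replaces the two parameters by their arithmetic and
    geometric means. *)
Lemma gauss_agm (a b : R) : 0 < a -> 0 < b ->
  gauss a b = gauss ((a + b) / 2) (sqrt (a * b)).
Proof.
  intros Ha Hb. assert (Hab : 0 < a * b) by nra.
  unfold gauss. rewrite ellL_landen by nra.
  replace (sqrt (a * b) ^ 2) with (a * b) by (rewrite pow2_sqrt; lra).
  replace (sqrt (a * b * (a ^ 2 + b ^ 2 + 2 * (a * b))) / 2)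
    with ((a + b) / 2 * sqrt (a * b)).
  - f_equal. field.
  - replace (a ^ 2 + b ^ 2 + 2 * (a * b)) with ((a + b) ^ 2) by ring.
    rewrite (sqrt_mult_alt (a * b)), sqrt_pow2 by lra. field.
Qed.

Lemma gauss_double (a b : R) : 0 < a -> 0 < b -> gauss (2 * a) (2 * b) = gauss a b / 2.
Proof.
  intros Ha Hb. unfold gauss. rewrite <- ellL_scale by nra. f_equal; ring.
Qed.

Lemma gauss_inj (a b c : R) : 0 < a -> 0 < b -> 0 < c -> gauss a b = gauss a c -> b = c.
Proof.
  intros Ha Hb Hc E. unfold gauss in E. destruct (Rtotal_order b c) as [H|[H|H]].
  - pose proof (ellL_strictly_antitone (a ^ 2 + b ^ 2) (a * b) (a ^ 2 + c ^ 2) (a * c)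
      ltac:(nra) ltac:(nra) ltac:(nra) ltac:(nra) ltac:(nra) ltac:(nra)). lra.
  - exact H.
  - pose proof (ellL_strictly_antitone (a ^ 2 + c ^ 2) (a * c) (a ^ 2 + b ^ 2) (a * b)
      ltac:(nra) ltac:(nra) ltac:(nra) ltac:(nra) ltac:(nra) ltac:(nra)). lra.
Qed.

(** * Evaluation by the arithmetic-geometric mean *)

Definition theta_diff (h : R) : R := theta_even (2 * h) - theta_odd (2 * h).

(** This is Jacobi's identity theta_3^4 = theta_4^4 + theta_2^4. *)
Lemma theta_pythagoras (h : R) : 0 < h ->
  theta_even h ^ 2 = theta_diff h ^ 2 + theta_odd h ^ 2.
Proof.
  intros Hh. rewrite (theta_odd_sqr h Hh), (theta_even_double h Hh).
  unfold theta_diff. ring.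
Qed.

Lemma theta_odd_le_even (h : R) : 0 < h -> theta_odd h <= theta_even h.
Proof.
  intros Hh. pose proof (theta_pythagoras h Hh). pose proof (theta_odd_pos h Hh).
  pose proof (theta_even_gt_1 h Hh). pose proof (pow2_ge_0 (theta_diff h)). nra.
Qed.

Lemma theta_diff_le_even (h : R) : 0 < h -> theta_diff h <= theta_even h.
Proof.
  intros Hh. rewrite (theta_even_double h Hh). unfold theta_diff.
  pose proof (theta_odd_pos (2 * h) ltac:(lra)). lra.
Qed.

Lemma theta_even_double_mean (h : R) : 0 < h ->
  theta_even (2 * h) = (theta_even h + theta_diff h) / 2.
Proof. intros Hh. rewrite (theta_even_double h Hh). unfold theta_diff. field. Qed.

Lemma theta_diff_double_sqr (h : R) : 0 < h ->
  theta_diff (2 * h) ^ 2 = theta_even h * theta_diff h.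
Proof.
  intros Hh. pose proof (theta_pythagoras (2 * h) ltac:(lra)) as H.
  rewrite (theta_even_double h Hh). unfold theta_diff at 2. lra.
Qed.

Lemma theta_diff_lower_bound (h : R) : 0 < h -> h - PI <= h * theta_diff h.
Proof.
  intros Hh. unfold theta_diff.
  pose proof (theta_even_gt_1 (2 * h) ltac:(lra)).
  pose proof (theta_odd_bounds (2 * h) ltac:(lra)). nra.
Qed.

(** Clear for large [h]; positivity then descends from [2 h] to [h] through the
    geometric-mean relation. *)
Lemma theta_diff_pos (h : R) : 0 < h -> 0 < theta_diff h.
Proof.
  intros Hh.
  assert (Hdesc : forall k x, 0 < x -> PI < 2 ^ k * x -> 0 < theta_diff x).
  { induction k as [|k IH]; intros x Hx Hk.
    - simpl in Hk. pose proof (theta_diff_lower_bound x Hx). nra.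
    - assert (H2 : 0 < theta_diff (2 * x)) by (apply IH; simpl in Hk; lra).
      pose proof (theta_diff_double_sqr x Hx). pose proof (theta_even_gt_1 x Hx). nra. }
  destruct (Pow_x_infinity 2 ltac:(rewrite Rabs_pos_eq; lra) (PI / h + 1)) as [k Hk].
  apply (Hdesc k h Hh). specialize (Hk k (le_n k)).
  rewrite Rabs_pos_eq in Hk by (apply pow_le; lra).
  apply Rmult_ge_compat_r with (r := h) in Hk; [|lra].
  replace ((PI / h + 1) * h) with (PI + h) in Hk by (field; lra). lra.
Qed.

(** At [2 h] the pair consists of the arithmetic and the geometric mean of the
    pair at [h]. *)
Lemma gauss_theta_diff_double (h : R) : 0 < h ->
  gauss (theta_even h) (theta_diff h) = gauss (theta_even (2 * h)) (theta_diff (2 * h)).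
Proof.
  intros Hh. pose proof (theta_even_gt_1 h Hh). pose proof (theta_diff_pos h Hh).
  rewrite gauss_agm by lra. f_equal.
  - symmetry. now apply theta_even_double_mean.
  - rewrite <- theta_diff_double_sqr by exact Hh. apply sqrt_pow2.
    apply Rlt_le, theta_diff_pos. lra.
Qed.

(** In this direction the pair at [h] is twice the pair of means of the pair at
    [2 h]. *)
Lemma gauss_theta_odd_double (h : R) : 0 < h ->
  gauss (theta_even (2 * h)) (theta_odd (2 * h)) = 2 * gauss (theta_even h) (theta_odd h).
Proof.
  intros Hh. pose proof (theta_even_gt_1 (2 * h) ltac:(lra)).
  pose proof (theta_odd_pos (2 * h) ltac:(lra)).
  replace (theta_even h)
    with (2 * ((theta_even (2 * h) + theta_odd (2 * h)) / 2))
    by (rewrite (theta_even_double h Hh); field).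
  replace (theta_odd h) with (2 * sqrt (theta_even (2 * h) * theta_odd (2 * h))).
  - rewrite gauss_double; [rewrite <- gauss_agm by lra; field|lra|].
    apply sqrt_lt_R0. nra.
  - rewrite <- (sqrt_pow2 (theta_odd h)) by (apply Rlt_le; now apply theta_odd_pos).
    rewrite theta_odd_sqr by exact Hh.
    replace (4 * theta_even (2 * h) * theta_odd (2 * h))
      with (2 ^ 2 * (theta_even (2 * h) * theta_odd (2 * h))) by ring.
    rewrite (sqrt_mult_alt (2 ^ 2)), sqrt_pow2 by lra. reflexivity.
Qed.

Lemma gauss_bounds_scaled (a b q r : R) : 0 < b <= a -> 0 < q ->
  gauss a b = q * r -> PI / 2 <= r * (q * a) /\ r * (q * b) <= PI / 2.
Proof.
  intros Hab Hq E. pose proof (gauss_bounds a b Hab) as [H1 H2]. split.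
  - apply Rmult_le_compat_r with (r := a) in H1; [|lra].
    replace (PI / (2 * a) * a) with (PI / 2) in H1 by (field; lra). nra.
  - apply Rmult_le_compat_r with (r := b) in H2; [|lra].
    replace (PI / (2 * b) * b) with (PI / 2) in H2 by (field; lra). nra.
Qed.

(** Doubling [h] for ever leaves Gauss's integral unchanged, while both
    arguments tend to 1. *)
Lemma gauss_theta_diff (h : R) : 0 < h ->
  gauss (theta_even h) (theta_diff h) = PI / 2.
Proof.
  intros Hh. set (r := gauss (theta_even h) (theta_diff h)).
  assert (Hk : forall k, 0 < 2 ^ k * h /\
    gauss (theta_even (2 ^ k * h)) (theta_diff (2 ^ k * h)) = 1 * r).
  { induction k as [|k [IH1 IH2]].
    - simpl. unfold r. rewrite !Rmult_1_l. easy.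
    - simpl. rewrite Rmult_assoc, <- gauss_theta_diff_double by exact IH1.
      split; [lra|exact IH2]. }
  assert (Hb : forall k, PI / 2 <= r + r * PI / h * (/ 2) ^ k /\
                         r <= PI / 2 + r * PI / h * (/ 2) ^ k).
  { intros k. destruct (Hk k) as [Hx E]. set (x := 2 ^ k * h) in *.
    assert (Eq : PI / h * (/ 2) ^ k = PI / x).
    { unfold x. rewrite pow_inv. field. split; [|apply pow_nonzero]; lra. }
    replace (r * PI / h * (/ 2) ^ k) with (r * (PI / h * (/ 2) ^ k)) by (unfold Rdiv; ring).
    rewrite Eq.
    pose proof (theta_diff_pos x Hx) as HD. pose proof (theta_diff_le_even x Hx) as HDE.
    destruct (gauss_bounds_scaled _ _ 1 r (conj HD HDE) Rlt_0_1 E) as [H1 H2].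
    assert (Hr : 0 < r).
    { apply (Rmult_lt_reg_r (1 * theta_even x)); [lra|]. pose proof PI_RGT_0. lra. }
    assert (HE : theta_even x <= 1 + PI / x).
    { pose proof (theta_even_bounds x Hx). apply (Rmult_le_reg_l x); [exact Hx|].
      replace (x * (1 + PI / x)) with (PI + x) by (field; lra). lra. }
    assert (HD' : 1 - PI / x <= theta_diff x).
    { pose proof (theta_diff_lower_bound x Hx). apply (Rmult_le_reg_l x); [exact Hx|].
      replace (x * (1 - PI / x)) with (x - PI) by (field; lra). lra. }
    nra. }
  apply Rle_antisym; apply le_of_geometric_error with (z := r * PI / h); apply Hb.
Qed.

(** Halving [h] for ever halves Gauss's integral each time, while [h] times either
    argument tends to the integral pi of [sech] over the line. *)
Lemma gauss_theta_odd (h : R) : 0 < h ->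
  gauss (theta_even h) (theta_odd h) = h / 2.
Proof.
  intros Hh. set (r := gauss (theta_even h) (theta_odd h)).
  assert (Hk : forall k, gauss (theta_even ((/ 2) ^ k * h)) (theta_odd ((/ 2) ^ k * h))
    = (/ 2) ^ k * r).
  { induction k as [|k IH].
    - simpl. unfold r. now rewrite !Rmult_1_l.
    - assert (Hp : 0 < (/ 2) ^ S k) by (apply pow_lt; lra).
      apply (Rmult_eq_reg_l 2); [|lra].
      rewrite <- gauss_theta_odd_double by nra.
      replace (2 * ((/ 2) ^ S k * h)) with ((/ 2) ^ k * h) by (simpl; field).
      rewrite IH. simpl. field. }
  assert (Hb : forall k, PI / 2 * h <= r * PI + r * h * (/ 2) ^ k /\
                         r * PI <= PI / 2 * h + 2 * r * h * (/ 2) ^ k).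
  { intros k. specialize (Hk k). assert (Hq : 0 < (/ 2) ^ k) by (apply pow_lt; lra).
    set (q := (/ 2) ^ k) in *. assert (Hx : 0 < q * h) by nra.
    pose proof (theta_odd_pos _ Hx) as HO. pose proof (theta_odd_le_even _ Hx) as HOE.
    destruct (gauss_bounds_scaled _ _ q r (conj HO HOE) Hq Hk) as [H1 H2].
    assert (Hr : 0 < r).
    { apply (Rmult_lt_reg_r (q * theta_even (q * h))); [nra|]. pose proof PI_RGT_0. lra. }
    pose proof (theta_even_bounds _ Hx) as HE. pose proof (theta_odd_bounds _ Hx) as HO'.
    split.
    - apply Rmult_le_compat_r with (r := h) in H1; [|lra]. nra.
    - apply Rmult_le_compat_r with (r := h) in H2; [|lra]. nra. }
  apply (Rmult_eq_reg_r PI); [|apply PI_neq0].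
  replace (h / 2 * PI) with (PI / 2 * h) by field.
  apply Rle_antisym.
  - apply le_of_geometric_error with (z := 2 * r * h). apply Hb.
  - apply le_of_geometric_error with (z := r * h). apply Hb.
Qed.

Definition lemniscate : R := RInt (fun s => / sqrt (1 + s ^ 4)) 0 1.

Lemma ellL_lemniscate : ellL 0 1 = 2 * lemniscate.
Proof.
  unfold ellL, ellF, lemniscate. rewrite sqrt_1. f_equal. apply RInt_ext.
  intros x _. unfold ell, quartic. do 2 f_equal. ring.
Qed.

(** At [h = PI] Gauss's integral has the same value pi/2 for [theta_diff] and for
    [theta_odd], so these agree; the modulus is then the lemniscatic one. *)
Lemma theta_odd_PI : PI * theta_odd PI = 2 * sqrt 2 * lemniscate.
Proof.
  pose proof PI_RGT_0 as HPI. pose proof (theta_odd_pos PI HPI) as Hc.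
  pose proof (theta_even_gt_1 PI HPI) as Ha. pose proof (theta_diff_pos PI HPI) as Hb.
  pose proof (gauss_theta_odd PI HPI) as HL.
  assert (E : theta_diff PI = theta_odd PI).
  { apply (gauss_inj (theta_even PI)); try lra. rewrite HL. now apply gauss_theta_diff. }
  pose proof (theta_pythagoras PI HPI) as Hpyth. rewrite E in Hpyth.
  set (a := theta_even PI) in *. set (c := theta_odd PI) in *.
  pose proof (sqrt_lt_R0 2 ltac:(lra)) as Hr. pose proof (sqrt_sqrt 2 ltac:(lra)) as Hr2.
  assert (Hac : a = sqrt 2 * c).
  { apply Rsqr_inj; [lra|nra|]. unfold Rsqr. nra. }
  (* One Landen step from x^4 + (2 c^2)^2 gives sum of squares 3 c^2 = a^2 + c^2 and
     product sqrt 2 c^2 = a c. *)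
  assert (H0 : ellL ((sqrt 2 * c) ^ 2 * 0) ((sqrt 2 * c) ^ 2 * 1) = gauss a c).
  { replace ((sqrt 2 * c) ^ 2 * 1) with (2 * c ^ 2) by nra. rewrite Rmult_0_r.
    rewrite ellL_landen by nra. unfold gauss. f_equal.
    - nra.
    - replace (2 * c ^ 2 * (0 + 2 * (2 * c ^ 2))) with (2 * (2 * c ^ 2) ^ 2) by ring.
      rewrite sqrt_mult_alt, sqrt_pow2 by nra. rewrite Hac. field. }
  rewrite ellL_scale, ellL_lemniscate, HL in H0 by nra.
  apply (Rmult_eq_compat_r (2 * c)) in H0.
  replace (2 * lemniscate / (sqrt 2 * c) * (2 * c)) with (2 * sqrt 2 * lemniscate) in H0.
  - rewrite H0. field.
  - apply (Rmult_eq_reg_r (sqrt 2)); [|lra].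
    replace (2 * lemniscate / (sqrt 2 * c) * (2 * c) * sqrt 2) with (2 * 2 * lemniscate)
      by (field; lra).
    replace (2 * sqrt 2 * lemniscate * sqrt 2)
      with (2 * (sqrt 2 * sqrt 2) * lemniscate) by ring.
    rewrite Hr2. ring.
Qed.

(** * The integrals of exp(-t^2) and exp(-t^4) *)

(** The square of an integral from 0 to [x] as a double integral over a square,
    cut along the diagonal: on the lower triangle the substitution t = s y turns
    phi(y) phi(t) dt dy into y phi(y) phi(s y) ds dy, and [Phi] is the inner
    integral over [y]. Differentiating in [x] avoids the double integral. *)
Lemma RInt_square (phi : R -> R) (Phi : R -> R -> R) (x : R) :
  (forall t, continuous phi t) ->
  (forall y s, is_derive (fun z => Phi z s) y (y * phi y * phi (s * y))) ->
  (forall y s, continuous (Phi y) s) ->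
  (forall s, Phi 0 s = 0) ->
  0 < x -> RInt phi 0 x ^ 2 = 2 * RInt (Phi x) 0 1.
Proof.
  intros Hphi Hder Hcont H0 Hx.
  enough (E : RInt phi 0 0 ^ 2 - 2 * RInt (Phi 0) 0 1 = RInt phi 0 x ^ 2 - 2 * RInt (Phi x) 0 1).
  { rewrite (RInt_point 0 phi) in E.
    rewrite (RInt_ext (Phi 0) (fun _ => 0)) in E by (intros s _; apply H0).
    rewrite RInt_const in E. unfold scal, zero in E. simpl in E. unfold mult in E.
    simpl in E. lra. }
  apply (eq_is_derive (fun y => RInt phi 0 y ^ 2 - 2 * RInt (Phi y) 0 1)); [|exact Hx].
  intros y _.
  assert (Hcs : forall s, continuous (fun s => phi (s * y)) s).
  { intros s. apply (continuous_comp (fun s => s * y) phi); [|apply Hphi].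
    apply (ex_derive_continuous (fun s => s * y) s). auto_derive. exact I. }
  assert (Hscale : y * RInt (fun s => phi (s * y)) 0 1 = RInt phi 0 y).
  { pose proof (RInt_comp_lin phi y 0 0 1 (continuous_ex_RInt _ _ _ Hphi)) as E.
    replace (y * 0 + 0) with 0 in E by ring. replace (y * 1 + 0) with y in E by ring.
    rewrite <- E, <- RInt_mult_l by exact Hcs.
    apply RInt_ext. intros s _. change (y * phi (s * y) = y * phi (y * s + 0)).
    do 2 f_equal. ring. }
  assert (D1 : is_derive (fun y => RInt phi 0 y ^ 2) y (2 * phi y * RInt phi 0 y)).
  { pose proof (is_derive_pow _ 2 _ _ (is_derive_RInt_upper phi 0 y Hphi)) as H.
    replace (2 * phi y * RInt phi 0 y) with (INR 2 * phi y * RInt phi 0 y ^ Init.Nat.pred 2)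
      by (simpl; ring). exact H. }
  assert (HDer : forall z s, Derive (fun u => Phi u s) z = z * phi z * phi (s * z)).
  { intros z s. apply is_derive_unique, Hder. }
  assert (D2 : is_derive (fun y => RInt (Phi y) 0 1) y
                 (RInt (fun s => Derive (fun u => Phi u s) y) 0 1)).
  { apply (is_derive_RInt_param Phi 0 1 y).
    - apply filter_forall. intros z s _. eexists. apply Hder.
    - intros s _.
      apply (continuity_2d_pt_ext (fun u v => u * phi u * phi (v * u))).
      + intros u v. now rewrite HDer.
      + assert (C : forall t, continuity_pt phi t)
          by (intros t; apply continuity_pt_filterlim, Hphi).
        apply continuity_2d_pt_mult; [apply continuity_2d_pt_mult|].
        * apply continuity_2d_pt_id1.
        * apply (continuity_1d_2d_pt_comp phi (fun u _ => u)); [apply C|].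
          apply continuity_2d_pt_id1.
        * apply (continuity_1d_2d_pt_comp phi (fun u v => v * u)); [apply C|].
          apply continuity_2d_pt_mult; [apply continuity_2d_pt_id2|apply continuity_2d_pt_id1].
    - apply filter_forall. intros z. now apply continuous_ex_RInt. }
  assert (E2 : RInt (fun s => Derive (fun u => Phi u s) y) 0 1 = phi y * RInt phi 0 y).
  { rewrite <- Hscale.
    transitivity (RInt (fun s => (phi y * y) * phi (s * y)) 0 1).
    - apply RInt_ext. intros s _. cbv beta. rewrite HDer.
      change (y * phi y * phi (s * y) = phi y * y * phi (s * y)). ring.
    - rewrite RInt_mult_l by exact Hcs. apply Rmult_assoc. }
  rewrite E2 in D2.
  assert (Z : 2 * phi y * RInt phi 0 y - 2 * (phi y * RInt phi 0 y) = 0) by ring.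
  refine (eq_ind _ (fun d : R => is_derive _ y d) _ 0 Z).
  apply (is_derive_minus (fun y => RInt phi 0 y ^ 2) (fun y => 2 * RInt (Phi y) 0 1));
    [exact D1|].
  now apply (is_derive_scal (fun y => RInt (Phi y) 0 1)).
Qed.

Definition int_exp_pow (p : nat) (x : R) : R := RInt (fun t => exp (- t ^ p)) 0 x.

Lemma exp_pow_continuous (p : nat) (x : R) : continuous (fun t => exp (- t ^ p)) x.
Proof.
  apply (ex_derive_continuous (fun t => exp (- t ^ p)) x). auto_derive. exact I.
Qed.

Lemma int_exp_pow_derive (p : nat) (x : R) : is_derive (int_exp_pow p) x (exp (- x ^ p)).
Proof. apply (is_derive_RInt_upper (fun t => exp (- t ^ p))), exp_pow_continuous. Qed.

Lemma int_exp_pow_continuous (p : nat) (x : R) : continuous (int_exp_pow p) x.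
Proof. apply (ex_derive_continuous (int_exp_pow p) x). eexists. apply int_exp_pow_derive. Qed.

Lemma int_exp_pow_0 (p : nat) : int_exp_pow p 0 = 0.
Proof. exact (RInt_point 0 (fun t => exp (- t ^ p))). Qed.

Lemma int_exp_pow_le (p : nat) (x y : R) : x <= y -> int_exp_pow p x <= int_exp_pow p y.
Proof.
  intros [H| ->]; [|lra].
  destruct (MVT_gen (int_exp_pow p) x y (fun t => exp (- t ^ p))) as [c [_ E]].
  - intros t _. apply int_exp_pow_derive.
  - intros t _. apply continuity_pt_filterlim, int_exp_pow_continuous.
  - pose proof (exp_pos (- c ^ p)). nra.
Qed.

Lemma int_exp_pow_nonneg (p : nat) (x : R) : 0 <= x -> 0 <= int_exp_pow p x.
Proof. intros H. rewrite <- (int_exp_pow_0 p). now apply int_exp_pow_le. Qed.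

Lemma int_exp_sqr_sqr (x : R) : 0 < x ->
  int_exp_pow 2 x ^ 2 = RInt (fun s => (1 - exp (- (x ^ 2 * (1 + s ^ 2)))) / (1 + s ^ 2)) 0 1.
Proof.
  intros Hx.
  assert (Hs : forall s, 0 < 1 + s ^ 2) by (intros s; pose proof (pow2_ge_0 s); lra).
  set (Phi := fun y s => (1 - exp (- (y ^ 2 * (1 + s ^ 2)))) / (2 * (1 + s ^ 2))).
  assert (Hc : forall y s, continuous (Phi y) s).
  { intros y s. apply (ex_derive_continuous (Phi y) s). unfold Phi. auto_derive.
    specialize (Hs s). simpl in Hs. lra. }
  unfold int_exp_pow. rewrite (RInt_square _ Phi); try assumption.
  - rewrite <- RInt_mult_l by apply Hc.
    apply RInt_ext. intros s _. unfold Phi. specialize (Hs s).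
    change (2 * ((1 - exp (- (x ^ 2 * (1 + s ^ 2)))) / (2 * (1 + s ^ 2)))
      = (1 - exp (- (x ^ 2 * (1 + s ^ 2)))) / (1 + s ^ 2)). field. lra.
  - intros t. apply exp_pow_continuous.
  - intros y s. specialize (Hs s). unfold Phi. auto_derive; [exact I|].
    rewrite (Rmult_assoc y (exp _)), <- exp_plus.
    replace (- y ^ 2 + - (s * y) ^ 2) with (- (y ^ 2 * (1 + s ^ 2))) by ring.
    simpl. field. simpl in Hs. lra.
  - intros s. unfold Phi. replace (- (0 ^ 2 * (1 + s ^ 2))) with 0 by ring.
    rewrite exp_0. unfold Rdiv. ring.
Qed.

Lemma sqrt_1_pow4_ge_1 (s : R) : 1 <= sqrt (1 + s ^ 4).
Proof.
  rewrite <- sqrt_1 at 1. apply sqrt_le_1_alt.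
  replace (s ^ 4) with ((s ^ 2) ^ 2) by ring. pose proof (pow2_ge_0 (s ^ 2)). lra.
Qed.

Lemma int_exp_quart_sqr (x : R) : 0 < x ->
  int_exp_pow 4 x ^ 2
    = RInt (fun s => int_exp_pow 2 (x ^ 2 * sqrt (1 + s ^ 4)) / sqrt (1 + s ^ 4)) 0 1.
Proof.
  intros Hx.
  assert (Hpos : forall s, 0 < 1 + s ^ 4).
  { intros s. replace (s ^ 4) with ((s ^ 2) ^ 2) by ring. pose proof (pow2_ge_0 (s ^ 2)). lra. }
  set (r := fun s => sqrt (1 + s ^ 4)).
  assert (Hr : forall s, 1 <= r s) by (intros s; apply sqrt_1_pow4_ge_1).
  assert (Hr2 : forall s, r s ^ 2 = 1 + s ^ 4).
  { intros s. unfold r. rewrite pow2_sqrt; [reflexivity|]. specialize (Hpos s). lra. }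
  assert (Hrc : forall s, ex_derive r s).
  { intros s. unfold r. auto_derive. specialize (Hpos s). simpl in *. lra. }
  set (Phi := fun y s => int_exp_pow 2 (y ^ 2 * r s) / (2 * r s)).
  assert (Hc : forall y s, continuous (Phi y) s).
  { intros y s. apply (ex_derive_continuous (Phi y) s). unfold Phi.
    apply ex_derive_div; [| |specialize (Hr s); lra].
    - apply (ex_derive_comp (int_exp_pow 2) (fun s => y ^ 2 * r s)).
      + eexists. apply int_exp_pow_derive.
      + apply ex_derive_scal, Hrc.
    - apply ex_derive_scal, Hrc. }
  unfold int_exp_pow at 1. rewrite (RInt_square _ Phi); try assumption.
  - rewrite <- RInt_mult_l by apply Hc.
    apply RInt_ext. intros s _. specialize (Hr s).
    change (2 * (int_exp_pow 2 (x ^ 2 * r s) / (2 * r s)) = int_exp_pow 2 (x ^ 2 * r s) / r s).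
    field. lra.
  - intros t. apply exp_pow_continuous.
  - intros y s. specialize (Hr s).
    replace (y * exp (- y ^ 4) * exp (- (s * y) ^ 4))
      with (/ (2 * r s) * (2 * y * r s * exp (- (y ^ 2 * r s) ^ 2))).
    + apply (is_derive_ext (fun z => / (2 * r s) * int_exp_pow 2 (z ^ 2 * r s))).
      * intros z. apply Rmult_comm.
      * apply (is_derive_scal (fun z => int_exp_pow 2 (z ^ 2 * r s))).
        apply (is_derive_comp (int_exp_pow 2) (fun z => z ^ 2 * r s)).
        -- apply int_exp_pow_derive.
        -- auto_derive; [exact I|ring].
    + rewrite (Rmult_assoc y (exp _)), <- exp_plus, Rpow_mult_distr, Hr2.
      replace (- y ^ 4 + - (s * y) ^ 4) with (- ((y ^ 2) ^ 2 * (1 + s ^ 4))) by ring.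
      field. lra.
  - intros s. unfold Phi. replace (0 ^ 2 * r s) with 0 by ring.
    rewrite int_exp_pow_0. unfold Rdiv. ring.
Qed.

Lemma RInt_inv_1_sqr : is_RInt (fun s => / (1 + s ^ 2)) 0 1 (PI / 4).
Proof.
  replace (PI / 4) with (atan 1 - atan 0) by (rewrite atan_1, atan_0; ring).
  apply (is_RInt_derive atan).
  - intros s _. apply is_derive_Reals, derivable_pt_lim_atan.
  - intros s _. apply (ex_derive_continuous (fun s => / (1 + s ^ 2)) s).
    auto_derive. pose proof (pow2_ge_0 s). simpl in *. lra.
Qed.

Lemma int_exp_sqr_sqr_bounds (x : R) : 0 < x ->
  (1 - exp (- x ^ 2)) * (PI / 4) <= int_exp_pow 2 x ^ 2 <= PI / 4.
Proof.
  intros Hx. rewrite int_exp_sqr_sqr by exact Hx.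
  assert (Hs : forall s, 0 < 1 + s ^ 2) by (intros s; pose proof (pow2_ge_0 s); lra).
  assert (Hi : forall s, 0 < / (1 + s ^ 2)) by (intros s; now apply Rinv_0_lt_compat).
  assert (Hex : ex_RInt (fun s => (1 - exp (- (x ^ 2 * (1 + s ^ 2)))) / (1 + s ^ 2)) 0 1).
  { apply continuous_ex_RInt. intros s.
    apply (ex_derive_continuous
      (fun s => (1 - exp (- (x ^ 2 * (1 + s ^ 2)))) / (1 + s ^ 2)) s).
    auto_derive. specialize (Hs s). simpl in Hs. lra. }
  split.
  - pose proof (is_RInt_scal _ _ _ (1 - exp (- x ^ 2)) _ RInt_inv_1_sqr) as H.
    refine (is_RInt_le _ _ 0 1 _ _ Rle_0_1 H (RInt_correct _ _ _ Hex) _).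
    intros s _. apply Rmult_le_compat_r; [apply Rlt_le, Hi|].
    apply Rplus_le_compat_l, Ropp_le_contravar.
    destruct (Req_dec s 0) as [->|Hs0].
    + right. f_equal. ring.
    + left. apply exp_increasing. pose proof (pow2_gt_0 s Hs0).
      pose proof (Rmult_lt_0_compat (x ^ 2) (s ^ 2) ltac:(nra) ltac:(lra)). lra.
  - refine (is_RInt_le _ _ 0 1 _ _ Rle_0_1 (RInt_correct _ _ _ Hex) RInt_inv_1_sqr _).
    intros s _. rewrite <- (Rmult_1_l (/ (1 + s ^ 2))).
    apply Rmult_le_compat_r; [apply Rlt_le, Hi|].
    pose proof (exp_pos (- (x ^ 2 * (1 + s ^ 2)))). lra.
Qed.

(** The square falls short of pi/4 by at most [exp (- x ^ 2) * (PI / 4)]. *)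
Lemma int_exp_sqr_lim : is_lim (int_exp_pow 2) p_infty (sqrt PI / 2).
Proof.
  replace (sqrt PI / 2) with (sqrt (PI / 4)).
  2: { rewrite sqrt_div_alt by lra. f_equal.
       replace 4 with (2 ^ 2) by ring. apply sqrt_pow2. lra. }
  apply sqrt_lim; [intros x Hx; apply int_exp_pow_nonneg; lra|].
  apply is_lim_le_le_loc with (fun x => (1 - / x) * (PI / 4)) (fun _ => PI / 4).
  - exists 1. intros x Hx. destruct (int_exp_sqr_sqr_bounds x ltac:(lra)) as [H1 H2].
    split; [|exact H2]. apply Rle_trans with (2 := H1).
    apply Rmult_le_compat_r; [pose proof PI_RGT_0; lra|].
    apply Rplus_le_compat_l, Ropp_le_contravar. rewrite exp_Ropp.
    apply Rinv_le_contravar; [lra|].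
    pose proof (exp_ineq1 (x ^ 2) ltac:(nra)). nra.
  - replace (Finite (PI / 4)) with (Rbar_mult (1 - 0) (PI / 4)) by (simpl; f_equal; ring).
    apply (is_lim_scal_r (fun x => 1 - / x) (PI / 4) p_infty (1 - 0)).
    apply is_lim_minus'; [apply is_lim_const|exact lim_inv_p].
  - apply is_lim_const.
Qed.

Lemma int_exp_sqr_le (x : R) : 0 < x -> int_exp_pow 2 x <= sqrt PI / 2.
Proof.
  intros Hx. pose proof PI_RGT_0. pose proof (int_exp_sqr_sqr_bounds x Hx) as [_ H1].
  pose proof (sqrt_pos PI). pose proof (sqrt_sqrt PI ltac:(lra)). nra.
Qed.

(** In [int_exp_quart_sqr] the inner factor lies between its value at [s = 0] and
    the full Gaussian integral, so it may be replaced by the latter in the limit. *)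
Lemma int_exp_quart_lim : is_lim (int_exp_pow 4) p_infty (sqrt (sqrt PI / 2 * lemniscate)).
Proof.
  apply sqrt_lim; [intros x Hx; apply int_exp_pow_nonneg; lra|].
  assert (Hc : forall s, continuous (fun s => / sqrt (1 + s ^ 4)) s).
  { intros s. apply (ex_derive_continuous (fun s => / sqrt (1 + s ^ 4)) s).
    pose proof (sqrt_1_pow4_ge_1 s). auto_derive.
    assert (0 < 1 + s ^ 4).
    { replace (s ^ 4) with ((s ^ 2) ^ 2) by ring. pose proof (pow2_ge_0 (s ^ 2)). lra. }
    simpl in *. repeat split; lra. }
  assert (Hex : forall x, ex_RInt
    (fun s => int_exp_pow 2 (x ^ 2 * sqrt (1 + s ^ 4)) / sqrt (1 + s ^ 4)) 0 1).
  { intros x. apply continuous_ex_RInt. intros s.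
    apply (continuous_mult (fun s => int_exp_pow 2 (x ^ 2 * sqrt (1 + s ^ 4)))); [|apply Hc].
    apply (continuous_comp (fun s => x ^ 2 * sqrt (1 + s ^ 4)) (int_exp_pow 2));
      [|apply int_exp_pow_continuous].
    apply (ex_derive_continuous (fun s => x ^ 2 * sqrt (1 + s ^ 4)) s).
    auto_derive.
    replace (s * (s * (s * (s * 1)))) with ((s ^ 2) ^ 2) by ring.
    pose proof (pow2_ge_0 (s ^ 2)). lra. }
  apply is_lim_le_le_loc
    with (fun x => int_exp_pow 2 (x ^ 2) * lemniscate) (fun _ => sqrt PI / 2 * lemniscate).
  - exists 0. intros x Hx. rewrite int_exp_quart_sqr by exact Hx.
    unfold lemniscate. rewrite <- (RInt_mult_l (int_exp_pow 2 (x ^ 2))) by exact Hc.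
    rewrite <- (RInt_mult_l (sqrt PI / 2)) by exact Hc.
    assert (Hk : forall k, ex_RInt (fun s => k * / sqrt (1 + s ^ 4)) 0 1).
    { intros k. apply continuous_ex_RInt. intros s.
      apply (continuous_scal_r k (fun s => / sqrt (1 + s ^ 4))), Hc. }
    split.
    + apply RInt_le; [lra|exact (Hk (int_exp_pow 2 (x ^ 2)))|exact (Hex x)|].
      intros s _. pose proof (sqrt_1_pow4_ge_1 s).
      apply Rmult_le_compat_r; [apply Rlt_le, Rinv_0_lt_compat; lra|].
      apply int_exp_pow_le. pose proof (pow2_ge_0 x). nra.
    + apply RInt_le; [lra|exact (Hex x)|exact (Hk (sqrt PI / 2))|].
      intros s _. pose proof (sqrt_1_pow4_ge_1 s).
      apply Rmult_le_compat_r; [apply Rlt_le, Rinv_0_lt_compat; lra|].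
      apply int_exp_sqr_le. apply Rmult_lt_0_compat; [nra|lra].
  - apply (is_lim_scal_r (fun x => int_exp_pow 2 (x ^ 2)) lemniscate p_infty (sqrt PI / 2)).
    apply (filterlim_comp _ _ _ (fun x => x ^ 2) (int_exp_pow 2) _ (Rbar_locally p_infty)).
    + intros P [M HM]. exists (1 + Rabs M). intros x Hx. apply HM.
      pose proof (Rabs_pos M). pose proof (Rle_abs M). nra.
    + exact int_exp_sqr_lim.
  - apply is_lim_const.
Qed.

(** * The Gamma function at 1/4 *)

Lemma sqrt_sqrt_Rpower (u : R) : 0 < u -> sqrt (sqrt u) = Rpower u (/ 4).
Proof.
  intros Hu. rewrite <- !Rpower_sqrt; [|exact Hu|now apply sqrt_lt_R0].
  rewrite Rpower_mult. f_equal. field.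
Qed.

Lemma int_exp_quart_root_derive (u : R) : 0 < u ->
  is_derive (fun u => 4 * int_exp_pow 4 (sqrt (sqrt u))) u (Rpower u (1 / 4 - 1) * exp (- u)).
Proof.
  intros Hu. set (v := sqrt u). set (w := sqrt v).
  assert (Hv : 0 < v) by now apply sqrt_lt_R0.
  assert (Hw : 0 < w) by now apply sqrt_lt_R0.
  assert (Hwv : w * w = v) by (apply sqrt_sqrt; lra).
  assert (Hvu : v * v = u) by (apply sqrt_sqrt; lra).
  assert (E : Rpower u (1 / 4 - 1) = / (w * v)).
  { replace (1 / 4 - 1) with (- (/ 4 + / 2)) by field.
    rewrite Rpower_Ropp, Rpower_plus, Rpower_sqrt by exact Hu.
    rewrite <- sqrt_sqrt_Rpower by exact Hu. reflexivity. }
  rewrite E.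
  replace (/ (w * v) * exp (- u)) with (4 * (/ (2 * v) * / (2 * w) * exp (- w ^ 4))).
  - apply (is_derive_scal (fun u => int_exp_pow 4 (sqrt (sqrt u)))).
    apply (is_derive_comp (int_exp_pow 4) (fun u => sqrt (sqrt u))).
    + apply int_exp_pow_derive.
    + auto_derive; [split; [exact Hu|split; [exact Hv|exact I]]|].
      fold v. fold w. field. lra.
  - replace (w ^ 4) with u by (rewrite <- Hvu, <- Hwv; ring). field. lra.
Qed.

(** The substitution u = t^4; the fourth root is written as an iterated square
    root to be continuous at the lower end 0. *)
Lemma Gamma_quarter : Gamma (1 / 4) = 4 * sqrt (sqrt PI / 2 * lemniscate).
Proof.
  unfold Gamma. apply is_RInt_gen_unique.
  set (l := sqrt (sqrt PI / 2 * lemniscate)).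
  set (f := fun u => 4 * int_exp_pow 4 (sqrt (sqrt u))).
  assert (H0 : filterlim f (at_right 0) (locally 0)).
  { replace 0 with (f 0) at 2 by (unfold f; rewrite !sqrt_0, int_exp_pow_0; ring).
    refine (filterlim_filter_le_1 f (@filter_le_within _ (locally 0) _ _) _).
    apply (continuous_scal_r 4 (fun u => int_exp_pow 4 (sqrt (sqrt u)))).
    apply (continuous_comp (fun u => sqrt (sqrt u)) (int_exp_pow 4));
      [|apply int_exp_pow_continuous].
    apply (continuous_comp sqrt sqrt); apply continuous_sqrt. }
  assert (Hl : filterlim f (Rbar_locally p_infty) (locally (4 * l))).
  { apply (is_lim_scal_l (fun u => int_exp_pow 4 (sqrt (sqrt u))) 4 p_infty l).
    apply (filterlim_comp _ _ _ (fun u => sqrt (sqrt u)) (int_exp_pow 4) _ (Rbar_locally p_infty)).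
    - apply (filterlim_comp _ _ _ sqrt sqrt _ (Rbar_locally p_infty));
        apply filterlim_sqrt_p.
    - exact int_exp_quart_lim. }
  assert (Hlim : filterlim (fun ab => f (snd ab) + - f (fst ab))
    (filter_prod (at_right 0) (Rbar_locally p_infty)) (locally (4 * l + - 0))).
  { apply (filterlim_comp_2 (fun ab : R * R => f (snd ab)) (fun ab => - f (fst ab)) Rplus
      (G := locally (4 * l)) (H := locally (- 0))).
    - exact (filterlim_comp _ _ _ snd f _ _ _ filterlim_snd Hl).
    - apply (filterlim_comp _ _ _ (fun ab : R * R => f (fst ab)) Ropp _ (locally 0)).
      + exact (filterlim_comp _ _ _ fst f _ _ _ filterlim_fst H0).
      + apply (filterlim_opp 0).
    - apply (filterlim_plus (4 * l) (- 0)). }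
  replace (4 * l + - 0) with (4 * l) in Hlim by ring.
  intros P HP. specialize (Hlim P HP). unfold filtermap in Hlim.
  assert (Hpos : filter_prod (at_right 0) (Rbar_locally p_infty)
    (fun ab => 0 < fst ab /\ 0 < snd ab)).
  { apply (Filter_prod _ _ _ (fun a => 0 < a) (fun b => 0 < b)).
    - exists (mkposreal 1 Rlt_0_1). intros y _ Hy. exact Hy.
    - exists 0. intros y Hy. exact Hy.
    - intros a b Ha Hb. now split. }
  refine (filter_imp (fun ab => P (f (snd ab) + - f (fst ab)) /\ (0 < fst ab /\ 0 < snd ab))
    _ _ (filter_and _ _ Hlim Hpos)).
  intros [a b] [Hab [Ha Hb]]. simpl in *.
  exists (f b + - f a). split; [|exact Hab].
  apply (is_RInt_derive f).
  - intros u [Hu _]. apply int_exp_quart_root_derive.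
    apply Rlt_le_trans with (2 := Hu). now apply Rmin_glb_lt.
  - intros u [Hu _].
    apply (ex_derive_continuous (fun u => Rpower u (1 / 4 - 1) * exp (- u)) u).
    unfold Rpower. auto_derive.
    apply Rlt_le_trans with (2 := Hu). now apply Rmin_glb_lt.
Qed.

Theorem theorem7 :
  is_series (fun n : nat => sech ((2 * INR n + 1) / 2 * PI))
    (Gamma (1 / 4) ^ 2 / (4 * sqrt 2 * Rpower PI (3 / 2))).
Proof.
  pose proof PI_RGT_0 as HPI. pose proof (sqrt_lt_R0 PI HPI) as Hr.
  pose proof (sqrt_lt_R0 2 ltac:(lra)) as Hr2. pose proof (sqrt_sqrt 2 ltac:(lra)) as H2.
  destruct (sech_half_sum_bounds PI HPI) as [s [Hs _]].
  pose proof theta_odd_PI as HT. pose proof (theta_odd_pos PI HPI) as Hpos.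
  assert (Es : theta_odd PI = 2 * s)
    by (unfold theta_odd; now rewrite (is_series_unique _ _ Hs)).
  assert (HJ : 0 <= sqrt PI / 2 * lemniscate).
  { assert (0 < lemniscate) by (apply (Rmult_lt_reg_l (2 * sqrt 2)); nra). nra. }
  replace (Gamma (1 / 4) ^ 2 / (4 * sqrt 2 * Rpower PI (3 / 2))) with s.
  - apply series_ext with (2 := Hs). intros n. f_equal. field.
  - replace (3 / 2) with (1 + / 2) by field.
    rewrite Rpower_plus, Rpower_1, Rpower_sqrt by exact HPI.
    rewrite Gamma_quarter, Rpow_mult_distr, pow2_sqrt by exact HJ.
    rewrite Es in HT.
    apply (Rmult_eq_reg_l (2 * PI)); [|lra].
    replace (2 * PI * s) with (PI * (2 * s)) by ring. rewrite HT.
    apply (Rmult_eq_reg_r (sqrt 2)); [|lra].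
    replace (2 * sqrt 2 * lemniscate * sqrt 2) with (2 * (sqrt 2 * sqrt 2) * lemniscate) by ring.
    rewrite H2. field. lra.
Qed.
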